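(* Every perfect matroid design is extremal. In particular, projective geometries $\mathrm{PG}(r-1,q)$ and affine geometries $\mathrm{AG}(r-1,q)$, as well as all their truncations, are extremal.
   Context: All matroids are finite. A perfect matroid design is a matroid $M$ for which there are integers $\alpha_0,\alpha_1,\ldots,\alpha_{r(M)}$ such that every flat $F$ of $M$ satisfies $|F|=\alpha_{r(F)}$. A truncation of a matroid $N$ of rank $r$ to rank $r-i$ is the matroid on $E(N)$ whose independent sets are the independent sets of $N$ of size at most $r-i$. Extremal matroids: a cyclic flat of a matroid is a flat that is a union of circuits; a matroid is nested if its cyclic flats form a chain under inclusion. For a matroid $M$ on $[n]$, its base polytope $\mathcal{P}(M)\subseteq\mathbb{R}^n$ is the convex hull of the characteristic vectors of its bases. For $X\subseteq\mathbb{R}^n$ let $\mathbb{I}(X)(x_1,\ldots,x_n)=\frac{1}{n!}\sum_{\sigma\in S_n}\bar{\mathbb{I}}(X)(x_{\sigma(1)},\ldots,x_{\sigma(n)})$, where $\bar{\mathbb{I}}(X)$ is the indicator function of $X$. Up to isomorphism there are exactly $\binom{n}{r}$ nested matroids of rank $r$ on $n$ elements; fix representatives $N_1,\ldots,N_{\binom nr}$ on $[n]$. For each rank-$r$ matroid $M$ on $[n]$ there are unique integers $c_1,\ldots,c_{\binom nr}$ with $\mathbb{I}(\mathcal{P}(M))=\sum_j c_j\,\mathbb{I}(\mathcal{P}(N_j))$, and the vector $(c_j)\in\mathbb{R}^{\binom nr}$ depends only on the isomorphism class of $M$. The polytope $\Omega_{r,n}$ is the convex hull of these vectors over all rank-$r$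 matroids on $n$ elements, and a matroid is extremal if its vector is a vertex of $\Omega_{r,n}$. *)

(* Defs.v *)
From HB Require Import structures.
From mathcomp Require Import boolp classical_sets reals numfun.
From mathcomp Require Import all_boot all_order all_fingroup all_algebra.

Set Implicit Arguments.
Unset Strict Implicit.
Unset Printing Implicit Defensive.

Import Order.TTheory GRing.Theory Num.Theory.

Local Open Scope ring_scope.

Record matroid (T : finType) := Matroid {
  indep : {set {set T}};
  indep0 : set0 \in indep;
  indepS : forall I J : {set T}, I \subset J -> J \in indep -> I \in indep;
  indep_augment : forall I J : {set T}, I \in indep -> J \in indep ->
    (#|I| < #|J|)%N -> exists2 x, x \in J :\: I & x |: I \in indep
}.

Section Matroid.
Variable T : finType.
Implicit Types (M : matroid T) (A B C F : {set T}).

Definition rank M A : nat := \max_(I in indep M | I \subset A) #|I|.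

Definition rk M : nat := rank M [set: T].

Definition basis M B : bool := maxset (fun I => I \in indep M) B.

Definition circuit M C : bool := minset (fun I => I \notin indep M) C.

Definition flat M F : bool :=
  [forall x, (x \notin F) ==> (rank M F < rank M (x |: F))%N].

Definition cyclic_flat M F : bool :=
  flat M F &&
  [exists S : {set {set T}}, [forall C in S, circuit M C] && (cover S == F)].

Definition nested M : Prop :=
  forall F G : {set T}, cyclic_flat M F -> cyclic_flat M G ->
    F \subset G \/ G \subset F.

Definition perfect_matroid_design M : Prop :=
  exists alpha : nat -> int, forall F, flat M F -> #|F|%:Z = alpha (rank M F).

Definition isomorphic M N : Prop :=
  exists2 f : T -> T, bijective f &
    forall I : {set T}, (f @: I \in indep N) = (I \in indep M).

End Matroid.

Section Truncation.
Variables (T : finType) (M : matroid T) (k : nat).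

Let tindep := [set I in indep M | (#|I| <= k)%N].

Fact truncation_indep0 : set0 \in tindep.
Proof. by rewrite inE indep0 cards0. Qed.

Fact truncation_indepS (I J : {set T}) :
  I \subset J -> J \in tindep -> I \in tindep.
Proof.
move=> sIJ; rewrite !inE => /andP[iJ Jk].
by rewrite (indepS sIJ iJ) (leq_trans (subset_leq_card sIJ)).
Qed.

Fact truncation_augment (I J : {set T}) : I \in tindep -> J \in tindep ->
  (#|I| < #|J|)%N -> exists2 x, x \in J :\: I & x |: I \in tindep.
Proof.
rewrite !inE => /andP[iI _] /andP[iJ Jk] ltIJ.
have [x xJI ixI] := indep_augment iI iJ ltIJ.
exists x => //; rewrite inE ixI /=; move: xJI; rewrite inE => /andP[xI _].
by rewrite cardsU1 xI (leq_trans ltIJ).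
Qed.

(* For k <= rk M this is the truncation of M to rank k. *)
Definition truncation : matroid T :=
  Matroid truncation_indep0 truncation_indepS truncation_augment.

End Truncation.

Section SubspaceMatroid.
Variables (T : finType) (F : fieldType) (m : nat) (W : T -> 'M[F]_m).
Hypothesis rankW : forall t, (\rank (W t) <= 1)%N.

Let sindep := [set S : {set T} | \rank (\sum_(t in S) W t)%MS == #|S|].

Lemma rank_span_le (S : {set T}) : (\rank (\sum_(t in S) W t)%MS <= #|S|)%N.
Proof.
rewrite -sum1_card; apply: leq_trans (_ : \sum_(t in S) \rank (W t) <= _)%N.
  elim/big_rec2: _ => [|t k A _ IH]; first by rewrite mxrank0.
  by rewrite (leq_trans (mxrank_adds_leqif _ _)) ?leq_add2l.
exact: leq_sum.
Qed.

Fact span_indep0 : set0 \in sindep.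
Proof. by rewrite inE big_set0 mxrank0 cards0. Qed.

Fact span_indepS (I J : {set T}) : I \subset J -> J \in sindep -> I \in sindep.
Proof.
move=> sIJ; rewrite !inE => /eqP rJ; rewrite eqn_leq rank_span_le /=.
have := rJ; rewrite (big_setID I) /= (setIidPr sIJ) => rJ'.
have := leq_trans (mxrank_adds_leqif (\sum_(t in I) W t)%MS _).1
  (leq_add (leqnn _) (rank_span_le (J :\: I))).
by rewrite rJ' -(cardsID I J) (setIidPr sIJ) leq_add2r.
Qed.

Fact span_augment (I J : {set T}) : I \in sindep -> J \in sindep ->
  (#|I| < #|J|)%N -> exists2 x, x \in J :\: I & x |: I \in sindep.
Proof.
rewrite !inE => /eqP rI /eqP rJ ltIJ.
have [sJI|] := boolP [forall x in J, (W x <= \sum_(t in I) W t)%MS].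
  have /mxrankS : (\sum_(t in J) W t <= \sum_(t in I) W t)%MS.
    by apply/sumsmx_subP => x xJ; apply: (forall_inP sJI).
  by rewrite rI rJ leqNgt ltIJ.
rewrite negb_forall_in => /exists_inP[x xJ nWx].
have xI : x \notin I by apply: contra nWx => xI; apply: (sumsmx_sup x).
exists x; first by rewrite inE xI.
rewrite inE eqn_leq rank_span_le cardsU1 xI add1n -rI /=.
rewrite big_setU1 //=; rewrite rank_ltmx // ltmxE addsmxSr /=.
by rewrite addsmx_sub submx_refl andbT.
Qed.

Definition subspace_matroid : matroid T :=
  Matroid span_indep0 span_indepS span_augment.

End SubspaceMatroid.

Section ProjectiveGeometry.
Variables (F : finFieldType) (d : nat).

(* A subspace of F^m is represented by the unique matrix A with A = <<A>>
   whose row space it is. *)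
Definition is_point (P : 'M[F]_d.+1) : bool :=
  (P == <<P>>%MS) && (\rank P == 1%N).

Fact point_rank (P : {P | is_point P}) : (\rank (val P) <= 1)%N.
Proof. by case: P => P /= /andP[_ /eqP->]. Qed.

Definition PG : matroid {P | is_point P} := subspace_matroid point_rank.

End ProjectiveGeometry.

Section AffineGeometry.
Variables (F : finFieldType) (d : nat).
Local Notation V := 'rV[F]_d.

Definition affinely_independent (S : {set V}) : bool :=
  [forall c : {ffun V -> F},
    (\sum_(v in S) c v == 0) && (\sum_(v in S) c v *: v == 0) ==>
    [forall v in S, c v == 0]].

(* The line spanned by (1, v). *)
Definition homog (v : V) : 'M[F]_(1 + d) := <<row_mx (1%:M : 'M_1) v>>%MS.

Fact homog_rank v : (\rank (homog v) <= 1)%N.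
Proof. by rewrite mxrank_gen rank_leq_row. Qed.

Lemma affine_combE (S : {set V}) (c : V -> F) :
  (\sum_(v in S) c v *: row_mx (1%:M : 'M_1) v == 0) =
  (\sum_(v in S) c v == 0) && (\sum_(v in S) c v *: v == 0).
Proof.
have -> : \sum_(v in S) c v *: row_mx (1%:M : 'M_1) v =
    row_mx (\sum_(v in S) c v)%:M (\sum_(v in S) c v *: v).
  elim/big_rec3: _ => [|v x y z _ ->]; first by rewrite raddf0 row_mx0.
  by rewrite scale_row_mx add_row_mx scalemx1 raddfD.
rewrite -row_mx0; apply/eqP/andP => [/eq_row_mx[e0 ->]|[/eqP-> /eqP->]].
  by split=> //; move/matrixP/(_ 0 0)/eqP: e0; rewrite !mxE eqxx mulr1n.
by rewrite raddf0.
Qed.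

Fact affinely_independentE :
  [set S | affinely_independent S] = indep (subspace_matroid homog_rank).
Proof.
apply/setP => S; rewrite !inE; apply/idP/idP => [/forallP indS|/eqP rS].
  suff H n (A : {set V}) : #|A| = n -> A \subset S ->
      \rank (\sum_(v in A) homog v)%MS = n by rewrite (H #|S|).
  elim: n A => [|n IHn] A cA sAS.
    by rewrite (cards0_eq cA) big_set0 mxrank0.
  have /card_gt0P[x xA] : (0 < #|A|)%N by rewrite cA.
  have cB : #|A :\ x| = n by move: cA; rewrite (cardsD1 x) xA => -[].
  have rB := IHn _ cB (subset_trans (subsetDl _ _) sAS).
  have nAx : ~~ (homog x <= \sum_(v in A :\ x) homog v)%MS.
    apply/negP; rewrite genmxE => /sub_sumsmxP[u Du].
    have Dw v : exists a, u v *m homog v == a *: row_mx (1%:M : 'M_1) v.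
      have /sub_rVP[a ->] : (u v *m homog v <= row_mx (1%:M : 'M_1) v)%MS.
        by rewrite (submx_trans (submxMl _ _)) ?genmxE.
      by exists a.
    pose a v := xchoose (Dw v).
    have aE v : u v *m homog v = a v *: row_mx (1%:M : 'M_1) v.
      by apply/eqP; exact: xchooseP (Dw v).
    pose c := [ffun v => if v == x then - 1 else
                 if v \in A then a v else 0 : F].
    have /implyP := indS c; rewrite -affine_combE => /(_ _)/forall_inP.
    case/(_ _ x (subsetP sAS _ xA))/negP.
      rewrite (big_setID A) /= (setIidPr sAS) addrC big1 => [|v]; last first.
        rewrite inE ffunE => /andP[/negPf vA _]; rewrite vA.
        by case: eqP vA => [->|]; rewrite ?xA // scale0r.
      rewrite add0r (big_setD1 x) //= ffunE eqxx scaleN1r Du addrC subr_eq0.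
      apply/eqP/eq_bigr => v; rewrite !inE ffunE => /andP[/negPf-> ->].
      by rewrite aE.
    by rewrite ffunE eqxx oppr_eq0 oner_eq0.
  apply/eqP; rewrite eqn_leq -{1}cA rank_span_le /=; last exact: homog_rank.
  rewrite -{1}rB; apply: rank_ltmx; rewrite (big_setD1 x xA) /= ltmxE.
  by rewrite addsmxSr addsmx_sub submx_refl andbT.
apply/forallP => c; apply/implyP; rewrite -affine_combE => /eqP c0.
apply/forall_inP => x xS; apply: contraT => cx.
have : (\sum_(v in S) homog v <= \sum_(v in S :\ x) homog v)%MS.
  rewrite (big_setD1 x) //= addsmx_sub submx_refl andbT genmxE.
  rewrite -(eqmx_scale _ cx); move: c0; rewrite (big_setD1 x) //=.
  move/eqP; rewrite addr_eq0 => /eqP->; rewrite eqmx_opp.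
  apply: summx_sub_sums => v _; rewrite scalemx_sub //.
  by rewrite genmxE.
move/mxrankS; rewrite rS leqNgt => /negP[].
apply: leq_ltn_trans (rank_span_le homog_rank _) _.
by rewrite [ltnRHS](cardsD1 x) xS.
Qed.

Fact affine_indep0 : set0 \in [set S | affinely_independent S].
Proof. by rewrite affinely_independentE indep0. Qed.

Fact affine_indepS (I J : {set V}) : I \subset J ->
  J \in [set S | affinely_independent S] ->
  I \in [set S | affinely_independent S].
Proof. by rewrite affinely_independentE; apply: indepS. Qed.

Fact affine_augment (I J : {set V}) :
  I \in [set S | affinely_independent S] ->
  J \in [set S | affinely_independent S] -> (#|I| < #|J|)%N ->
  exists2 x, x \in J :\: I & x |: I \in [set S | affinely_independent S].
Proof. by rewrite affinely_independentE; apply: indep_augment. Qed.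

Definition AG : matroid V := Matroid affine_indep0 affine_indepS affine_augment.

End AffineGeometry.

Section Polytopes.
Variable R : realType.

Definition convex_hull (J : finType) (A : set {ffun J -> R}) :
    set {ffun J -> R} :=
  [set x | exists k (p : 'I_k -> {ffun J -> R}) (w : 'I_k -> R),
    [/\ forall i, A (p i), forall i, 0 <= w i, \sum_i w i = 1 &
        forall j, x j = \sum_i w i * p i j]]%classic.

(* v is a face of dimension 0: the unique maximiser over P of some linear
   functional. *)
Definition is_vertex (J : finType) (P : set {ffun J -> R}) (v : {ffun J -> R}) :
    Prop :=
  P v /\ exists u : {ffun J -> R},
    forall x, P x -> x <> v -> \sum_j u j * x j < \sum_j u j * v j.

Variable T : finType.
Implicit Types M : matroid T.

Definition char_vec (B : {set T}) : {ffun T -> R} := [ffun e => (e \in B)%:R].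

Definition base_polytope M : set {ffun T -> R} :=
  convex_hull [set x | exists2 B, basis M B & x = char_vec B]%classic.

Definition sym_indic (X : set {ffun T -> R}) (x : {ffun T -> R}) : R :=
  ((#|T|)`!%:R)^-1 * \sum_(s : {perm T}) \1_X [ffun e => x (s e)].

(* The ground set of n elements is an arbitrary T with n = #|T|, rather than
 [n]; N is a choice of representatives of the isomorphism classes of nested
   matroids of rank r on T. *)
Definition nested_representatives (r : nat)
    (N : 'I_('C(#|T|, r)) -> matroid T) : Prop :=
  [/\ forall j, nested (N j) /\ rk (N j) = r,
      forall i j, isomorphic (N i) (N j) -> i = j &
      forall M, nested M -> rk M = r -> exists j, isomorphic M (N j)].

(* The relation "v is the vector (c_j) of M". *)
Definition nested_vector (r : nat) (N : 'I_('C(#|T|, r)) -> matroid T) M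
    (v : {ffun 'I_('C(#|T|, r)) -> R}) : Prop :=
  exists2 c : 'I_('C(#|T|, r)) -> int, v = [ffun j => (c j)%:~R] &
    forall x, sym_indic (base_polytope M) x =
      \sum_j (c j)%:~R * sym_indic (base_polytope (N j)) x.

Definition Omega (r : nat) (N : 'I_('C(#|T|, r)) -> matroid T) :
    set {ffun 'I_('C(#|T|, r)) -> R} :=
  convex_hull [set v | exists2 M, rk M = r & nested_vector N M v]%classic.

Definition extremal M : Prop :=
  forall N : 'I_('C(#|T|, rk M)) -> matroid T, nested_representatives N ->
    exists2 v, nested_vector N M v & is_vertex (Omega N) v.

End Polytopes.

(* Main.v *)
Require Import Defs.
From mathcomp Require Import boolp classical_sets reals numfun.
From mathcomp Require Import all_boot all_order all_fingroup all_algebra.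
From mathcomp Require Import lra mxabelem finfield.

(* Idea. The vector (c_j) of M and its G-invariant, the distribution of the rank
   sequences of M along all linear orders of the ground set, determine each other
   linearly.  For a perfect matroid design with flat sizes alpha, the linear
   functional "sum of |cl A| - alpha_(r A) over the initial segments A of all
   orders, minus a large penalty for orders with an initial segment A of size
   larger than alpha_(r A)" is negative on every matroid of the same rank, except
   on the designs with the same alpha, where it vanishes.  All of these have the
   same G-invariant, because the rank increments of a random order form a Markov
   chain with transition probabilities given by alpha.

   Existence of (c_j): if x violates the rank constraints exactly on the sets of
   V, then A |-> A :|: m, with m maximizing x(A) - r(A), contracts the poset V, so
   the alternating sum over the chains in V is 1 if V is empty and 0 otherwise.
   Expanding it writes the indicator of P(M) through polytopes cut out by chains
   of rank constraints, which are base polytopes of nested matroids.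

   Linear dependence of the G-invariant on the indicators: the number of orders
   with rank sequence >= t counts nonempty intersections of permuted copies of P(M)
   with a fixed polyhedron, and nonemptiness is the Euler characteristic.

   Uniqueness of (c_j): along an order adapted to its cyclic flats a nested matroid
   has its pointwise smallest rank sequence, which determines it. *)

Set Implicit Arguments.
Unset Strict Implicit.
Unset Printing Implicit Defensive.

Import Order.TTheory GRing.Theory Num.Theory.

(** * Rank and closure *)

Section MatroidRank.
Variables (T : finType) (M : matroid T).
Implicit Types A B I J F : {set T}.

Lemma indep_le_rank I A : I \in indep M -> I \subset A -> #|I| <= rank M A.
Proof. by move=> iI sIA; apply: leq_bigmax_cond; rewrite iI. Qed.

Lemma rank_le A k :
  (forall I, I \in indep M -> I \subset A -> #|I| <= k) -> rank M A <= k.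
Proof. by move=> h; apply/bigmax_leqP => I /andP[]; apply: h. Qed.

Lemma rankS A B : A \subset B -> rank M A <= rank M B.
Proof.
move=> sAB; apply: rank_le => I iI sIA.
by rewrite indep_le_rank // (subset_trans sIA).
Qed.

Lemma rank_le_card A : rank M A <= #|A|.
Proof. by apply: rank_le => I _; apply: subset_leq_card. Qed.

Lemma indep_extend I A : I \in indep M -> I \subset A ->
  exists J, [/\ J \in indep M, I \subset J, J \subset A & #|J| = rank M A].
Proof.
move=> iI sIA; pose P J := (J \in indep M) && (J \subset A).
have [J /maxsetP[/andP[iJ sJA] maxJ] sIJ] := @maxset_exists _ P I (introT andP (conj iI sIA)).
exists J; split=> //; apply/eqP; rewrite eqn_leq indep_le_rank //=.
apply: rank_le => W iW sWA; rewrite leqNgt; apply/negP => /(indep_augment iJ iW).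
case=> x /setDP[xW xJ] ixJ; move: xJ; rewrite -(maxJ _ _ (subsetUr [set x] J)).
  by rewrite setU11.
by rewrite /P ixJ subUset sub1set (subsetP sWA).
Qed.

Lemma rank_witness A :
  exists J, [/\ J \in indep M, J \subset A & #|J| = rank M A].
Proof. by have [J [? _ ? ?]] := indep_extend (indep0 M) (sub0set A); exists J. Qed.

Lemma rank_card_indep A : #|A| <= rank M A -> A \in indep M.
Proof.
move=> h; have [J [iJ sJA cJ]] := rank_witness A.
by have /eqP <- : J == A by rewrite eqEcard sJA cJ.
Qed.

(** Extend a largest independent [I] in [A :&: B] to a largest independent [J] in [A :|: B], and
    count [J :&: A] and [J :&: B]: together they cover [J], and their overlap contains [I]. *)
Lemma rank_submod A B :
  rank M (A :|: B) + rank M (A :&: B) <= rank M A + rank M B.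
Proof.
have [I [iI sI cI]] := rank_witness (A :&: B).
have sIAB : I \subset A :|: B.
  by rewrite (subset_trans sI) // (subset_trans (subsetIl _ _)) ?subsetUl.
have [J [iJ sIJ sJ cJ]] := indep_extend iI sIAB.
have iJA : #|J :&: A| <= rank M A.
  by rewrite indep_le_rank ?subsetIr // (indepS _ iJ) ?subsetIl.
have iJB : #|J :&: B| <= rank M B.
  by rewrite indep_le_rank ?subsetIr // (indepS _ iJ) ?subsetIl.
apply: leq_trans (leq_add iJA iJB).
rewrite -cardsUI -setIUr (setIidPl sJ) cJ leq_add2l -cI subset_leq_card //.
by rewrite setIACA setIid subsetI sIJ.
Qed.

Lemma rankU1 x A : rank M (x |: A) <= (rank M A).+1.
Proof.
have := leq_trans (leq_addr _ _) (rank_submod [set x] A).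
by move/leq_trans; apply; rewrite -add1n leq_add2r -(cards1 x) rank_le_card.
Qed.

Definition cl A : {set T} := [set x | rank M (x |: A) == rank M A].

Lemma sub_cl A : A \subset cl A.
Proof. by apply/subsetP => x xA; rewrite inE (setUidPr _) ?sub1set. Qed.

Lemma rank_cl A : rank M (cl A) = rank M A.
Proof.
apply/eqP; rewrite eqn_leq (rankS (sub_cl A)) andbT.
have [I [iI sI cI]] := rank_witness A.
have [J [iJ sIJ sJ cJ]] := indep_extend iI (subset_trans sI (sub_cl A)).
rewrite -cJ -cI leqNgt; apply/negP => ltIJ.
have [x /setDP[xJ xI]] : exists x, x \in J :\: I.
  by apply/set0Pn; rewrite setD_eq0; apply: contraL ltIJ => /subset_leq_card; rewrite leqNgt.
have := subsetP sJ _ xJ; rewrite inE => /eqP rx.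
suff: #|x |: I| <= rank M (x |: A) by rewrite rx cardsU1 xI add1n cI ltnn.
by rewrite indep_le_rank ?setUS // (indepS _ iJ) // subUset sub1set xJ.
Qed.

Lemma flat_cl A : flat M (cl A).
Proof.
apply/forallP => x; apply/implyP; rewrite inE => h.
rewrite rank_cl (leq_trans _ (rankS (setUS _ (sub_cl A)))) //.
by rewrite ltn_neqAle eq_sym h rankS ?subsetUr.
Qed.

Lemma cl_flat F : flat M F -> cl F = F.
Proof.
move=> /forallP fF; apply/eqP; rewrite eqEsubset sub_cl andbT.
apply/subsetP => x; rewrite inE => /eqP rx; apply: contraT => xF.
by have := implyP (fF x) xF; rewrite rx ltnn.
Qed.

Lemma flatT : flat M [set: T].
Proof. by apply/forallP => x; rewrite inE. Qed.

Lemma basisP B : reflect (B \in indep M /\ #|B| = rk M) (basis M B).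
Proof.
apply: (iffP maxsetP) => [[iB maxB]|[iB cB]].
  split=> //; have [J [iJ sBJ _ cJ]] := indep_extend iB (subsetT B).
  by rewrite /rk -cJ (maxB J).
split=> // C iC sBC; apply/eqP; rewrite eq_sym eqEcard sBC cB.
exact: indep_le_rank (subsetT _).
Qed.

(* The basis is built greedily along the chain. *)
Lemma chain_basis (A : nat -> {set T}) n :
  (forall k, A k \subset A k.+1) -> A n = [set: T] ->
  exists2 B, basis M B & forall k, k <= n -> #|B :&: A k| = rank M (A k).
Proof.
move=> sA An.
suff [B [iB sB hB]] : exists B, [/\ B \in indep M, B \subset A n &
    forall k, k <= n -> #|B :&: A k| = rank M (A k)].
  exists B => //; apply/basisP; split=> //.
  by have := hB n (leqnn n); rewrite An setIT.
elim: n {An} => [|n [B [iB sB hB]]].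
  have [B [iB sB cB]] := rank_witness (A 0).
  by exists B; split=> // k; rewrite leqn0 => /eqP ->; rewrite (setIidPl sB).
have [J [iJ sBJ sJ cJ]] := indep_extend iB (subset_trans sB (sA n)).
exists J; split=> // k; rewrite leq_eqVlt => /orP[/eqP->|].
  by rewrite (setIidPl sJ).
rewrite ltnS => kn; apply/eqP; rewrite eqn_leq; apply/andP; split.
  by rewrite indep_le_rank ?subsetIr // (indepS _ iJ) ?subsetIl.
by rewrite -hB // subset_leq_card // setSI.
Qed.

End MatroidRank.

(** * Linear orders and their initial segments *)

Section Prefix.
Variable T : finType.
Implicit Types (s : {perm T}) (A F : {set T}).

(* A permutation s is read as the linear order on T in which the position of
   x is enum_rank (s x). *)
Definition segment s k : {set T} := [set x | enum_rank (s x) < k].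

Lemma segmentE s k x : (x \in segment s k) = (enum_rank (s x) < k).
Proof. by rewrite inE. Qed.

Lemma segmentS s j k : j <= k -> segment s j \subset segment s k.
Proof. by move=> jk; apply/subsetP => x; rewrite !inE => /leq_trans; apply. Qed.

Lemma segmentT s : segment s #|T| = [set: T].
Proof. by apply/setP => x; rewrite !inE ltn_ord. Qed.

Lemma segment0 s : segment s 0 = set0.
Proof. by apply/setP => x; rewrite !inE ltn0. Qed.

Lemma segment_next s (i : 'I_#|T|) :
  segment s i.+1 = (s^-1)%g (enum_val i) |: segment s i.
Proof.
apply/setP => x; rewrite !inE ltnS leq_eqVlt; congr (_ || _).
by rewrite -[RHS](inj_eq (@perm_inj _ s)) permKV -(inj_eq enum_rank_inj) enum_valK.
Qed.

Lemma card_segment s k : k <= #|T| -> #|segment s k| = k.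
Proof.
elim: k => [|k IH] kT; first by rewrite segment0 cards0.
rewrite (segment_next s (Ordinal kT)) cardsU1 IH 1?ltnW //=.
by rewrite inE permKV enum_valK /= ltnn.
Qed.

Definition is_chain (C : {set {set T}}) : bool :=
  [forall A in C, forall B in C, (A \subset B) || (B \subset A)].

Lemma is_chainP (C : {set {set T}}) :
  reflect (forall A B, A \in C -> B \in C -> A \subset B \/ B \subset A) (is_chain C).
Proof.
apply: (iffP forall_inP) => [h A B AC BC | h A AC].
  exact: orP (forall_inP (h A AC) B BC).
by apply/forall_inP => B BC; apply/orP; apply: h.
Qed.

(** Sorting the elements by the number of members of [C] that miss them puts each member of the
    chain in front of its complement. *)
Lemma chain_segment (C : {set {set T}}) : is_chain C ->
  exists s, forall F, F \in C -> segment s #|F| = F.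
Proof.
move=> /is_chainP chC.
(* A lexicographic pair written in base [#|T|]: ties in the number of missing members are broken by
   [enum_rank], which makes the keys distinct. *)
pose key x := #|[set F in C | x \notin F]| * #|T| + enum_rank x.
have key_inj : injective key.
  move=> x y /(congr1 (modn^~ #|T|)); rewrite !modnMDl !modn_small //.
  by move/ord_inj/enum_rank_inj.
pose f x := #|[set y | key y < key x]|.
have f_lt x : f x < #|T|.
  rewrite -cardsT; apply: proper_card; apply/properP; split; first exact: subsetT.
  by exists x; rewrite ?inE ?ltnn.
have f_mono x y : key x < key y -> f x < f y.
  move=> xy; apply: proper_card; apply/properP; split.
    by apply/subsetP => z; rewrite !inE => /ltn_trans; apply.
  by exists x; rewrite !inE ?ltnn.
pose g x := enum_val (Ordinal (f_lt x)) : T.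
have g_inj : injective g.
  move=> x y /enum_val_inj/(congr1 val)/= fxy; apply: key_inj; apply/eqP.
  by case: (ltngtP (key x) (key y)) => // /f_mono; rewrite fxy ltnn.
exists (perm g_inj) => F FC; apply/eqP; rewrite eq_sym eqEcard.
rewrite card_segment ?max_card // leqnn andbT.
have key_lt x y : x \in F -> y \notin F -> key x < key y.
  move=> xF yF.
  have lt : #|[set G in C | x \notin G]| < #|[set G in C | y \notin G]|.
    apply: proper_card; apply/properP; split; last by exists F; rewrite !inE FC ?xF.
    apply/subsetP => G; rewrite !inE => /andP[GC xG]; rewrite GC /=.
    by have [/subsetP/(_ _ xF)|/subsetP sGF] := chC _ _ FC GC; [rewrite (negPf xG)|
       apply: contra yF => /sGF].
  rewrite /key; apply: leq_trans (_ : (#|[set G in C | x \notin G]|.+1 * #|T|) <= _).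
    by rewrite mulSn addnC ltn_add2r.
  by rewrite (leq_trans _ (leq_addr _ _)) // leq_mul2r lt orbT.
apply/subsetP => x xF; rewrite inE permE enum_valK /= /f.
apply: proper_card; apply/properP; split; last by exists x; rewrite ?inE ?ltnn.
apply/subsetP => y; rewrite inE => yx; apply: contraT => /(key_lt _ _ xF).
by rewrite ltnNge ltnW.
Qed.

Lemma set_segment A : exists s, segment s #|A| = A.
Proof.
have [|s hs] := @chain_segment [set A]; last by exists s; rewrite hs ?inE.
by apply/is_chainP => B C /set1P-> /set1P->; left.
Qed.

End Prefix.

Local Open Scope ring_scope.

(** * Base polytopes *)

Lemma seq_min (R : realFieldType) (a : R) (s : seq R) :
  exists2 m, m \in a :: s & forall z, z \in a :: s -> m <= z.
Proof.
elim: s a => [|b s IH] a.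
  by exists a => [|z]; rewrite ?inE // => /eqP->.
have [m ms hm] := IH b; have [am|ma] := leP a m.
  exists a => [|z]; rewrite inE ?eqxx // => /orP[/eqP-> //|/hm].
  exact: le_trans.
exists m => [|z]; first by rewrite inE ms orbT.
by rewrite inE => /orP[/eqP->|/hm //]; apply: ltW.
Qed.

Section IntegralPolytope.
Variables (R : realType) (T : finType) (FF : {set {set T}}).
Variable b : {set T} -> nat.
Implicit Types (x y : {ffun T -> R}) (A B : {set T}).

Lemma sum_delta A (i : T) : \sum_(e in A) (e == i)%:R = (i \in A)%:R :> R.
Proof.
have [iA|iA] := boolP (i \in A).
  rewrite (bigD1 i) //= eqxx big1 ?addr0 // => e /andP[_ /negPf->] //.
by rewrite big1 // => e eA; case: eqP iA eA => // -> /negPf->.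
Qed.

Definition setwise_bounded x :=
  [/\ forall e, 0 <= x e <= 1,
      forall A, A \in FF -> \sum_(e in A) x e <= (b A)%:R &
      \sum_e x e = (b [set: T])%:R].

Let tight x A := \sum_(e in A) x e == (b A)%:R.
Let slack x := [set A in FF | \sum_(e in A) x e < (b A)%:R].
Let fractional x := [set e | 0 < x e < 1].

(** The largest feasible step along [e_i - e_j] makes a coordinate integral or a slack constraint
    tight. Sets tight at [x] contain both or neither of [i] and [j], so they stay tight and the
    potential drops. *)
Lemma exchange_move x i j : setwise_bounded x -> i != j ->
    i \in fractional x -> j \in fractional x ->
    (forall A, A \in FF -> tight x A -> (i \in A) = (j \in A)) ->
  exists2 eps : R, 0 < eps &
    let y := [ffun e => x e + eps * ((e == i)%:R - (e == j)%:R)] in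
    setwise_bounded y /\
    (#|fractional y| + #|slack y| < #|fractional x| + #|slack x|)%N.
Proof.
move=> [x01 xb xT] nij; rewrite !inE => /andP[i0 i1] /andP[j0 j1] tij.
(* Step lengths at which a bound is reached: besides [1 - x i], these are [x j] and the slacks of
   the sets containing [i] but not [j], the only sets whose sum grows. *)
pose s := x j :: [seq (b A)%:R - \sum_(e in A) x e | A <- enum FF
                    & (i \in A) && (j \notin A)].
have [eps eps_s eps_min] := seq_min (1 - x i) s.
have eps_gt0 : 0 < eps.
  move: eps_s; rewrite !inE => /or3P[/eqP->|/eqP->|]; rewrite ?subr_gt0 //.
  case/mapP=> A; rewrite mem_filter mem_enum => /andP[/andP[iA jA] AF] ->.
  rewrite subr_gt0 lt_neqAle xb // andbT.
  by apply: contra jA => tA; rewrite -(tij A).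
exists eps => // y.
have yA A : \sum_(e in A) y e =
    \sum_(e in A) x e + eps * ((i \in A)%:R - (j \in A)%:R).
  rewrite -!sum_delta -sumrB mulr_sumr -big_split /=.
  by apply: eq_bigr => e _; rewrite ffunE.
have eps_i : x i + eps <= 1 by rewrite addrC -lerBrDr eps_min // inE eqxx.
have eps_j : eps <= x j by rewrite eps_min // !inE eqxx orbT.
have yi : y i = x i + eps by rewrite ffunE eqxx (negPf nij) subr0 mulr1.
have yj : y j = x j - eps.
  by rewrite ffunE eqxx eq_sym (negPf nij) sub0r mulrN1.
have ye e : e != i -> e != j -> y e = x e.
  by move=> /negPf ei /negPf ej; rewrite ffunE ei ej subrr mulr0 addr0.
have sub_fr : fractional y \subset fractional x.
  apply/subsetP => e; rewrite !inE; have [->|ei] := eqVneq e i; first by rewrite i0.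
  by have [->|ej] := eqVneq e j; [rewrite j0 | rewrite ye].
have sub_sl : slack y \subset slack x.
  apply/subsetP => A; rewrite !inE => /andP[AF ltA].
  rewrite AF lt_neqAle xb // andbT /=; apply: contraL ltA => tA.
  by rewrite yA (tij A) // subrr mulr0 addr0 (eqP tA) ltxx.
split; first split.
- move=> e; have [->|ei] := eqVneq e i; first by rewrite yi; lra.
  have [->|ej] := eqVneq e j; first by rewrite yj; lra.
  by rewrite ye.
- move=> A AF; have := xb A AF; rewrite yA.
  have [iA|iA] := boolP (i \in A); have [jA|jA] := boolP (j \in A) => /= h.
  + by rewrite subrr mulr0 addr0.
  + rewrite subr0 mulr1 addrC -lerBrDr eps_min // !inE; apply/orP; right; apply/orP; right.
    by apply/mapP; exists A; rewrite // mem_filter mem_enum iA jA AF.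
  + lra.
  + by rewrite subrr mulr0 addr0.
- have := yA [set: T]; rewrite !inE subrr mulr0 addr0.
  by rewrite !(eq_bigl _ _ (in_setT (T:=T))) xT.
have [/eqP ey|ney] := boolP (eps == 1 - x i).
  rewrite -addSn leq_add ?subset_leq_card // proper_card //.
  rewrite properE sub_fr; apply/subsetPn; exists i; first by rewrite inE i0.
  by rewrite inE yi ey addrC subrK ltxx andbF.
have [/eqP ey|nej] := boolP (eps == x j).
  rewrite -addSn leq_add ?subset_leq_card // proper_card //.
  rewrite properE sub_fr; apply/subsetPn; exists j; first by rewrite inE j0.
  by rewrite inE yj ey subrr ltxx.
move: eps_s; rewrite !inE (negPf ney) (negPf nej) => /mapP[A].
rewrite mem_filter mem_enum => /andP[/andP[iA jA] AF] eA.
rewrite -addnS leq_add ?subset_leq_card // proper_card //.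
rewrite properE sub_sl; apply/subsetPn; exists A.
  by rewrite inE AF -subr_gt0 -eA.
by rewrite inE yA iA (negPf jA) subr0 mulr1 eA addrC subrK ltxx andbF.
Qed.

Hypothesis FFT : [set: T] \in FF.
Hypothesis tight_cap : forall x A B, setwise_bounded x -> A \in FF -> B \in FF ->
  tight x A -> tight x B -> A :&: B \in FF /\ tight x (A :&: B).

(* Tight sets through a fractional i but not j cannot exist when i, j lie in a
   minimal tight set meeting the fractional support, so x can be moved both ways
   along e_i - e_j until one more constraint becomes tight. *)
Lemma setwise_bounded_hull x : setwise_bounded x ->
  exists w : {set T} -> R, [/\ forall B, 0 <= w B,
    forall B, w B != 0 -> setwise_bounded (char_vec R B),
    \sum_B w B = 1 & forall e, x e = \sum_B w B * (e \in B)%:R].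
Proof.
have [n] := ubnP (#|fractional x| + #|slack x|).
elim: n x => // n IH x; rewrite ltnS => le_n Qx.
have [x01 xb xT] := Qx.
have [/eqP fr0|/set0Pn[i0 i0fr]] := boolP (fractional x == set0).
  have xE e : x e = (x e == 1)%:R.
    have := in_set0 e; rewrite -fr0 inE; have := x01 e.
    case/andP; rewrite !le_eqVlt => /orP[/eqP<- _ _|->].
      by rewrite eq_sym oner_eq0.
    by case/orP => [/eqP->|->]; rewrite ?eqxx.
  pose B0 := [set e | x e == 1].
  have xB0 : x = char_vec R B0 by apply/ffunP => e; rewrite ffunE inE.
  exists (fun B => (B == B0)%:R); split=> [B||| e].
  - by rewrite ler0n.
  - by move=> B; have [->|_] := eqVneq B B0; [rewrite -xB0 | rewrite eqxx].
  - by rewrite (bigD1 B0) //= eqxx big1 ?addr0 // => B /negPf->.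
  rewrite (bigD1 B0) //= eqxx big1 ?addr0 => [|B /negPf->]; last by rewrite mul0r.
  by rewrite mul1r inE.
pose P S := [&& S \in FF, tight x S & [exists i in S, i \in fractional x]].
have [S /minsetP[/and3P[SF tS /exists_inP[i iS ifr]] minS]] : exists S, minset P S.
  suff /minset_exists[S mS _] : P [set: T] by exists S.
  rewrite /P FFT /tight (eq_bigl _ _ (in_setT (T:=T))) xT eqxx /=.
  by apply/exists_inP; exists i0.
(* With [i] as the only fractional coordinate in [S], the sum over [S] would lie strictly between
   two integers, yet it equals [b S]. *)
have [j [jS jfr nij]] : exists j, [/\ j \in S, j \in fractional x & i != j].
  apply: contrapT => nj.
  have : \sum_(e in S) x e = x i + #|[set e in S :\ i | x e == 1]|%:R.
    rewrite (big_setD1 i) //=; congr (_ + _).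
    rewrite -sum1_card natr_sum big_mkcond [RHS]big_mkcond /=.
    apply: eq_bigr => e _; rewrite !inE.
    case: (boolP (e != i)) => //= ei; case: (boolP (e \in S)) => //= eS.
    have := x01 e; rewrite !le_eqVlt; case: eqP => [<-|_] /=.
      by rewrite eq_sym oner_eq0.
    case/andP => e0 /orP[/eqP->|e1]; first by rewrite eqxx.
    by case: nj; exists e; rewrite eq_sym ei inE e0 e1.
  move/eqP: tS => ->; move: ifr; rewrite inE => /andP[xi0 xi1] eb.
  set k := #|_| in eb.
  have : (k%:R < (b S)%:R :> R) && ((b S)%:R < k.+1%:R :> R).
    by rewrite eb -natr1; lra.
  by rewrite !ltr_nat ltnS => /andP[/leq_trans h /h]; rewrite ltnn.
have hij A : A \in FF -> tight x A -> (i \in A) = (j \in A).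
  move=> AF tA; have [SA tSA] := tight_cap Qx SF AF tS tA.
  apply/idP/idP => h; [have := ifr|have := jfr] => hfr.
    suff : S :&: A = S by move/setIidPl/subsetP; apply.
    apply: minS; last exact: subsetIl.
    by rewrite /P SA tSA; apply/exists_inP; exists i; rewrite // inE iS.
  suff : S :&: A = S by move/setIidPl/subsetP; apply.
  apply: minS; last exact: subsetIl.
  by rewrite /P SA tSA; apply/exists_inP; exists j; rewrite // inE jS.
have [e1 e1_gt0 [Q1 m1]] := exchange_move Qx nij ifr jfr hij.
have [||e2 e2_gt0 [Q2 m2]] := @exchange_move x j i Qx _ jfr ifr.
- by rewrite eq_sym.
- by move=> A AF tA; rewrite hij.
have [w1 [w1_ge0 w1Q w1_sum w1E]] := IH _ (leq_trans m1 le_n) Q1.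
have [w2 [w2_ge0 w2Q w2_sum w2E]] := IH _ (leq_trans m2 le_n) Q2.
have e12 : 0 < e1 + e2 by rewrite addr_gt0.
have e12' : e1 + e2 != 0 by rewrite gt_eqF.
(* Since [l1 * e1 = l2 * e2], the two opposite displacements cancel and [x] is this convex
   combination of the moved points. *)
pose l1 := e2 / (e1 + e2); pose l2 := e1 / (e1 + e2).
have l1_ge0 : 0 <= l1 by rewrite divr_ge0 ?ltW.
have l2_ge0 : 0 <= l2 by rewrite divr_ge0 ?ltW.
have l12 : l1 + l2 = 1 by rewrite -mulrDl addrC divff.
exists (fun B => l1 * w1 B + l2 * w2 B); split=> [B|B||e].
- by rewrite addr_ge0 // mulr_ge0.
- have [w10|w10 _] := eqVneq (w1 B) 0; last exact: w1Q.
  rewrite w10 mulr0 add0r mulf_eq0 negb_or => /andP[_]; exact: w2Q.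
- by rewrite big_split /= -!mulr_sumr w1_sum w2_sum !mulr1.
under eq_bigr do rewrite mulrDl -[l1 * _ * _]mulrA -[l2 * _ * _]mulrA.
rewrite big_split /= -!mulr_sumr -w1E -w2E !ffunE [l1 * _]mulrDr [l2 * _]mulrDr.
rewrite addrACA -mulrDl l12 mul1r.
have -> : l2 * (e2 * ((e == j)%:R - (e == i)%:R)) =
   - (l1 * (e1 * ((e == i)%:R - (e == j)%:R))).
  rewrite -!mulrN opprB !mulrA /l1 /l2; congr (_ * _).
  by rewrite mulrAC [RHS]mulrAC (mulrC e1).
by rewrite subrr addr0.
Qed.

End IntegralPolytope.

(** * Inequalities for matroid base polytopes *)

Section BasePolytope.
Variables (R : realType) (T : finType).
Implicit Types (M : matroid T) (x : {ffun T -> R}).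

(** Merging equal points turns a convex combination of arbitrary length into one weight per set,
    supported on the bases. *)
Lemma base_polytopeP M x : base_polytope M x <->
  exists w : {set T} -> R, [/\ forall B, 0 <= w B,
    forall B, w B != 0 -> basis M B,
    \sum_B w B = 1 & forall e, x e = \sum_B w B * (e \in B)%:R].
Proof.
split=> [[k [p [w [hp w_ge0 w_sum xE]]]] | [w [w_ge0 wB w_sum xE]]].
  have /choice[f hf] : forall i, exists B, basis M B /\ p i = char_vec R B.
    by move=> i; have [B bB pB] := hp i; exists B.
  exists (fun B => \sum_(i | f i == B) w i); split=> [B|B||e].
  - exact: sumr_ge0.
  - apply: contraR => nB; rewrite big1 // => i /eqP fi.
    by case: (hf i) => + _; rewrite fi (negPf nB).
  - by rewrite -w_sum (partition_big f predT).
  rewrite xE (partition_big f predT) //=; apply: eq_bigr => B _.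
  by rewrite mulr_suml; apply: eq_bigr => i /eqP <-; rewrite (hf i).2 ffunE.
pose S := [set B | basis M B].
have sumS (f : {set T} -> R) :
    \sum_(i < #|S|) w (enum_val i) * f (enum_val i) = \sum_B w B * f B.
  rewrite -(big_enum_val (fun B => w B * f B)) /= [RHS](bigID (mem S)) /=.
  rewrite [X in _ = _ + X]big1 ?addr0 // => B.
  by rewrite inE => nB; rewrite (contraNeq (@wB B) nB) mul0r.
exists #|S|, (fun i => char_vec R (enum_val i)), (fun i => w (enum_val i)).
split=> [i|//||e].
- by exists (enum_val i) => //; have := enum_valP i; rewrite inE.
- have := sumS (fun=> 1); under eq_bigr do rewrite mulr1.
  by under [in RHS]eq_bigr do rewrite mulr1; move=> ->.
- rewrite xE -sumS; by apply: eq_bigr => i _; rewrite ffunE.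
Qed.

Lemma char_vec_sum (A B : {set T}) :
  \sum_(e in A) char_vec R B e = #|B :&: A|%:R.
Proof.
rewrite -sum1_card natr_sum big_mkcond [RHS]big_mkcond /=.
by apply: eq_bigr => e _; rewrite ffunE inE; case: (e \in A); case: (e \in B).
Qed.

Lemma hull_le (w : {set T} -> R) x (A : {set T}) (k : R) :
  (forall B, 0 <= w B) -> \sum_B w B = 1 ->
  (forall e, x e = \sum_B w B * (e \in B)%:R) ->
  (forall B, w B != 0 -> #|B :&: A|%:R <= k) -> \sum_(e in A) x e <= k.
Proof.
move=> w_ge0 w_sum xE hk; under eq_bigr do rewrite xE.
have -> : k = \sum_B w B * k by rewrite -mulr_suml w_sum mul1r.
rewrite exchange_big /= ler_sum // => B _.
have [->|wB] := eqVneq (w B) 0; first by rewrite big1 ?mul0r // => e _; rewrite mul0r.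
rewrite -mulr_sumr ler_wpM2l // (le_trans _ (hk B wB)) // -char_vec_sum.
by apply: ler_sum => e _; rewrite ffunE.
Qed.

(* Edmonds' description; for a matroid defined by a chain of rank constraints
   the chain itself serves as FF. *)
Lemma base_polytope_facets M (FF : {set {set T}}) (b : {set T} -> nat) :
    (forall B, basis M B =
       (#|B| == b [set: T]) && [forall A in FF, #|B :&: A| <= b A]%N) ->
    [set: T] \in FF ->
    (forall x A B, setwise_bounded FF b x -> A \in FF -> B \in FF ->
       \sum_(e in A) x e == (b A)%:R -> \sum_(e in B) x e == (b B)%:R ->
       A :&: B \in FF /\ \sum_(e in A :&: B) x e == (b (A :&: B))%:R) ->
  forall x, base_polytope M x <-> setwise_bounded FF b x.
Proof.
move=> bM FFT capFF x; split=> [/base_polytopeP[w [w_ge0 wB w_sum xE]]|].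
  split.
  - move=> e; rewrite xE sumr_ge0 => [|B _]; last by rewrite mulr_ge0 ?ler0n.
    rewrite -[X in _ <= X]w_sum /= ler_sum // => B _.
    by case: (e \in B); rewrite ?mulr1 ?mulr0.
  - move=> A AF; apply: (hull_le w_ge0 w_sum xE) => B /wB.
    by rewrite bM ler_nat => /andP[_ /forall_inP/(_ _ AF)].
  - under eq_bigr do rewrite xE.
    rewrite exchange_big /=.
    transitivity (\sum_B w B * (b [set: T])%:R); last by rewrite -mulr_suml w_sum mul1r.
    apply: eq_bigr => B _.
    have [->|/wB] := eqVneq (w B) 0; first by rewrite big1 ?mul0r // => e _; rewrite mul0r.
    rewrite bM => /andP[/eqP<- _]; rewrite -mulr_sumr; congr (_ * _).
    by rewrite -sum1_card natr_sum [RHS]big_mkcond; apply: eq_bigr => e _; case: (e \in B).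
move=> /(setwise_bounded_hull FFT capFF)[w [w_ge0 wB w_sum xE]].
apply/base_polytopeP; exists w; split=> // B /wB[_ hF hT].
rewrite bM; apply/andP; split.
  have := char_vec_sum [set: T] B; rewrite setIT (eq_bigl _ _ (in_setT (T:=T))) hT.
  by move/eqP; rewrite eqr_nat eq_sym.
by apply/forall_inP => A AF; rewrite -(ler_nat R) -char_vec_sum hF.
Qed.

Definition rank_bounded M x :=
  [/\ forall e, 0 <= x e <= 1,
      forall A : {set T}, \sum_(e in A) x e <= (rank M A)%:R &
      \sum_e x e = (rk M)%:R].

Lemma sum_setUI (x : {ffun T -> R}) (A B : {set T}) :
  \sum_(e in A :|: B) x e + \sum_(e in A :&: B) x e =
  \sum_(e in A) x e + \sum_(e in B) x e.
Proof.
have -> : \sum_(e in A :|: B) x e = \sum_(e in A) x e + \sum_(e in B :\: A) x e.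
  rewrite (big_setID A) /= setUK; congr (_ + _); apply: eq_bigl => e.
  by rewrite !inE; case: (e \in A).
by rewrite -addrA; congr (_ + _); rewrite [RHS](big_setID A) /= setIC addrC.
Qed.

Lemma base_polytope_rank M x : base_polytope M x <-> rank_bounded M x.
Proof.
have -> : rank_bounded M x <-> setwise_bounded [set: {set T}] (rank M) x.
  by split=> -[h1 h2 h3]; split=> // A; have := h2 A; rewrite inE; apply.
apply: base_polytope_facets => [B||{}x A B [_ xr _] _ _ /eqP tA /eqP tB]; first 1 last.
- by rewrite inE.
(* Submodularity uncrosses: with [A] and [B] tight, the bounds on union and intersection force the
   intersection to be tight. *)
- split; rewrite ?inE //.
  have := sum_setUI x A B; rewrite tA tB.
  have := rank_submod M A B; rewrite -(ler_nat R) !natrD.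
  have := xr (A :|: B); have := xr (A :&: B); rewrite !inE => /(_ isT) h1 /(_ isT) h2 h3 h4.
  by rewrite eq_le h1 /=; lra.
  apply/basisP/andP => [[iB cB]|[/eqP cB /forall_inP hB]].
    split; first by rewrite cB.
    apply/forall_inP => A _; rewrite indep_le_rank ?subsetIr //.
    exact: indepS (subsetIl _ _) iB.
  split=> //; apply: rank_card_indep; have := hB B; rewrite inE setIid; exact.
Qed.

End BasePolytope.

(** * Expansion into nested matroids *)

Section ChainMatroid.
Variables (T : finType) (C : {set {set T}}) (b : {set T} -> nat).
Hypothesis chC : is_chain C.

Lemma chain_max (C' : {set {set T}}) (A0 : {set T}) : is_chain C' -> A0 \in C' ->
  exists2 A, A \in C' & forall B, B \in C' -> B \subset A.
Proof.
move=> /is_chainP ch A0C; have [A AC maxA] := @arg_maxnP _ A0 (mem C') (fun A => #|A|) A0C.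
exists A => // B BC; have [//|sAB] := ch _ _ BC AC.
by have /eqP -> : A == B by rewrite eqEcard sAB; apply: maxA.
Qed.

Lemma is_chainS (C1 C2 : {set {set T}}) : C1 \subset C2 -> is_chain C2 -> is_chain C1.
Proof.
by move=> /subsetP s /is_chainP ch; apply/is_chainP => A B /s AC /s; apply: ch.
Qed.

Let cindep := [set I : {set T} | [forall A in C, #|I :&: A| <= b A]%N].

Fact chain_indep0 : set0 \in cindep.
Proof. by rewrite inE; apply/forall_inP => A _; rewrite set0I cards0. Qed.

Fact chain_indepS (I J : {set T}) : I \subset J -> J \in cindep -> I \in cindep.
Proof.
move=> sIJ; rewrite !inE => /forall_inP hJ; apply/forall_inP => A AC.
by rewrite (leq_trans _ (hJ A AC)) // subset_leq_card // setSI.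
Qed.

(** Adding [x] can only break a constraint that is tight for [I] and whose set contains [x]. All
    tight sets lie in the largest one [F], where [J] has no more elements than [I], so some element
    of [J] outside [F] is missing from [I]. *)
Fact chain_augment (I J : {set T}) : I \in cindep -> J \in cindep ->
  (#|I| < #|J|)%N -> exists2 x, x \in J :\: I & x |: I \in cindep.
Proof.
rewrite !inE => /forall_inP hI /forall_inP hJ ltIJ.
pose tight := [set A in C | #|I :&: A| == b A].
have [F [FJ FI]] : exists F, (#|J :&: F| <= #|I :&: F|)%N /\
    forall A, A \in tight -> A \subset F.
  have [->|[A0 A0t]] := set_0Vmem tight.
    by exists set0; split=> [|A]; rewrite ?setI0 ?cards0 ?inE.
  have [|F Ft maxF] := @chain_max tight A0 _ A0t.
    by apply: is_chainS chC; apply/subsetP => A; rewrite inE => /andP[].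
  by exists F; split=> //; move: Ft; rewrite inE => /andP[/hJ + /eqP->].
have [x xJ xIF] : exists2 x, x \in J :\: F & x \notin I :\: F.
  apply/subsetPn; apply: contraL ltIJ => /subset_leq_card le.
  by rewrite -leqNgt -(cardsID F J) -(cardsID F I) leq_add.
move: xJ xIF; rewrite !inE => /andP[xF xJ]; rewrite xF /= => xI.
exists x; rewrite inE ?xI //; apply/forall_inP => A AC.
have [xA|xA] := boolP (x \in A); last first.
  have -> : (x |: I) :&: A = I :&: A; last exact: hI.
  by apply/setP => y; rewrite !inE; case: eqP => // ->; rewrite (negPf xA) !andbF.
have nt : (#|I :&: A| < b A)%N.
  rewrite ltn_neqAle hI // andbT; apply: contra xF => tA.
  by apply: (subsetP (FI A _)) => //; rewrite inE AC.
rewrite setIUl (leq_trans (leq_card_setU _ _)) //.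
by rewrite (leq_trans _ nt) // -add1n leq_add2r -(cards1 x) subset_leq_card // subsetIl.
Qed.

(** The laminar matroid of the family [C] with capacities [b]. *)
Definition chain_matroid : matroid T :=
  Matroid chain_indep0 chain_indepS chain_augment.

Lemma chain_matroid_rank A : A \in C -> (rank chain_matroid A <= b A)%N.
Proof.
move=> AC; apply: rank_le => I; rewrite inE => /forall_inP/(_ A AC) + sIA.
by rewrite (setIidPl sIA).
Qed.

(** A circuit lies in a member [A] whose capacity it exceeds by exactly one, so it already spans
    [A]. *)
Lemma chain_matroid_circuit X : circuit chain_matroid X ->
  exists A, [/\ A \in C, X \subset A & rank chain_matroid A = rank chain_matroid X].
Proof.
case/minsetP; rewrite inE negb_forall_in => /exists_inP[A AC XA] minX.
rewrite -ltnNge in XA.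
have sXA : X \subset A.
  apply/setIidPl; apply: minX; last exact: subsetIl.
  rewrite inE negb_forall_in; apply/exists_inP; exists A => //.
  by rewrite -setIA setIid -ltnNge.
exists A; split=> //; apply/eqP; rewrite eqn_leq (rankS _ sXA) andbT.
rewrite (leq_trans (chain_matroid_rank AC)) //.
have [x xX] : exists x, x \in X.
  apply/set0Pn; rewrite -card_gt0.
  by rewrite (leq_trans _ (subset_leq_card (subsetIl X A))) // (leq_ltn_trans _ XA).
have iX : X :\ x \in indep chain_matroid.
  apply: contraT => nX; have := minX _ nX (subsetDl _ _).
  by move=> e; move: xX; rewrite -e !inE eqxx.
rewrite (setIidPl sXA) (cardsD1 x) xX add1n ltnS in XA.
exact: leq_trans XA (indep_le_rank iX (subsetDl _ _)).
Qed.

(** Each circuit of the flat [F] spans a member of [C] containing it. The largest of these members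
    contains all the circuits, hence [F], and lies in [F] because a circuit of [F] spans it. *)
Lemma chain_matroid_cyclic_flat F : cyclic_flat chain_matroid F ->
  F = set0 \/ F \in C.
Proof.
case/andP=> fF /existsP[S /andP[/forall_inP cS /eqP covS]].
have [S0|[X0 X0S]] := set_0Vmem S.
  by left; rewrite -covS S0 /cover big_set0.
pose C' := [set A in C | [exists X in S, (X \subset A) &&
  (rank chain_matroid A == rank chain_matroid X)]].
have C'P X : X \in S -> exists2 A, A \in C' & X \subset A.
  move=> XS; have [A [AC sXA rA]] := chain_matroid_circuit (cS X XS).
  exists A => //; rewrite inE AC; apply/exists_inP; exists X => //.
  by rewrite sXA rA eqxx.
have [A0 A0C' _] := C'P _ X0S.
have [|A AC' maxA] := @chain_max C' A0 _ A0C'.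
  by apply: is_chainS chC; apply/subsetP => A; rewrite inE => /andP[].
right; suff -> : F = A by move: AC'; rewrite inE => /andP[].
have sFA : F \subset A.
  rewrite -covS; apply/bigcupsP => X XS.
  by have [B /maxA sBA sXB] := C'P _ XS; apply: subset_trans sXB sBA.
apply/eqP; rewrite eqEsubset sFA -(cl_flat fF); apply/subsetP => x xA.
move: AC'; rewrite inE => /andP[_ /exists_inP[X XS /andP[_ /eqP rA]]].
rewrite inE eqn_leq (rankS _ (subsetUr _ _)) andbT.
apply: leq_trans (_ : rank chain_matroid A <= _)%N.
  by rewrite rankS // subUset sub1set xA.
by rewrite rA rankS // -covS; apply: bigcup_sup XS.
Qed.

Lemma chain_matroid_nested : nested chain_matroid.
Proof.
move=> F G /chain_matroid_cyclic_flat[->|FC]; first by left; apply: sub0set.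
move=> /chain_matroid_cyclic_flat[->|GC]; first by right; apply: sub0set.
exact: (is_chainP _ chC).
Qed.

End ChainMatroid.

(** * Sign-reversing involutions and sums over chains *)

Section AlternatingSums.

(** Fixed points of [phi] are harmless: the sum equals its own negative. *)
Lemma sum_involution (J : finType) (P : pred J) (f : J -> int) (phi : J -> J) :
  (forall j, P j -> P (phi j)) -> (forall j, P j -> phi (phi j) = j) ->
  (forall j, P j -> f (phi j) = - f j) -> \sum_(j | P j) f j = 0.
Proof.
move=> Pphi phiK fN.
have : \sum_(j | P j) f j = - \sum_(j | P j) f j.
  rewrite [LHS](reindex_onto phi phi) => [|j Pj]; last exact: phiK.
  rewrite -sumrN; apply: eq_big => j; last first.
    by case/andP => Pj /eqP e; rewrite fN // -e; apply: Pphi.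
  apply/andP/idP => [[Pj /eqP e]|Pj]; first by rewrite -e; apply: Pphi.
  by rewrite Pphi // phiK.
by move=> e; apply/eqP; move/eqP: e; rewrite -addr_eq0 -mulr2n mulrn_eq0.
Qed.

Variable U : finType.
Implicit Types (a : U) (D X : {set U}).

Definition toggle a D : {set U} := if a \in D then D :\ a else a |: D.

Lemma toggleK a : involutive (toggle a).
Proof.
move=> D; rewrite /toggle; have [aD|aD] := boolP (a \in D).
  by rewrite !inE eqxx /= setD1K.
by rewrite setU11 setU1K.
Qed.

Lemma toggle_sign a D : (-1) ^+ #|toggle a D| = - (-1) ^+ #|D| :> int.
Proof.
rewrite /toggle; have [aD|aD] := boolP (a \in D).
  by rewrite [in RHS](cardsD1 a) aD exprS mulN1r opprK.
by rewrite cardsU1 aD exprS mulN1r.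
Qed.

Lemma in_toggle a D z : z != a -> (z \in toggle a D) = (z \in D).
Proof. by move=> za; rewrite /toggle; case: ifP; rewrite !inE ?za // (negPf za). Qed.

Lemma toggle_sub a D X : a \in X -> (toggle a D \subset X) = (D \subset X).
Proof.
by move=> aX; apply/subsetP/subsetP => h z;
  (have [-> //|za] := eqVneq z a); have := h z; rewrite in_toggle.
Qed.

Lemma sum_subsets_sign X :
  \sum_(D : {set U} | D \subset X) (-1) ^+ #|D| = (X == set0)%:R :> int.
Proof.
have [->|/set0Pn[a aX]] := eqVneq X set0.
  rewrite (big_pred1 set0) ?cards0 ?expr0 // => D.
  by rewrite subset0.
apply: (@sum_involution _ _ _ (toggle a)) => D; rewrite ?toggle_sub //.
  by rewrite toggleK.
by rewrite toggle_sign.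
Qed.

End AlternatingSums.

Section ChainSums.
Variable T : finType.
Implicit Types (C D V : {set {set T}}) (A B m : {set T}).

(* The map A |-> A :|: m contracts the poset V onto its part above m, hence its
   reduced Euler characteristic vanishes.  The involution toggles m :|: A in a
   chain, where A is the largest member not containing m. *)
Lemma sum_chains_contractible V m : m \in V ->
    (forall A, A \in V -> A :|: m \in V) ->
  \sum_(C | is_chain C && (C \subset V)) (-1) ^+ #|C| = 0 :> int.
Proof.
move=> mV Vm; pose low C := [set B in C | ~~ (m \subset B)].
pose W C := cover (low C) :|: m.
have WV C : is_chain C && (C \subset V) -> W C \in V.
  case/andP=> ch sCV; have [l0|[A0 A0l]] := set_0Vmem (low C).
    by rewrite /W l0 /cover big_set0 set0U.
  have sl : low C \subset C by apply/subsetP => B; rewrite inE => /andP[].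
  have [A Al maxA] := chain_max (is_chainS sl ch) A0l.
  have -> : W C = A :|: m.
    congr (_ :|: m); apply/eqP; rewrite eqEsubset; apply/andP; split.
      exact/bigcupsP.
    exact: bigcup_sup.
  by rewrite Vm // (subsetP sCV) // (subsetP sl).
have sub_mW C : m \subset W C by apply: subsetUr.
(* The toggled set contains [m], so [low C], and with it [W C], stays unchanged; this makes the
   toggle an involution. *)
have lowT C : low (toggle (W C) C) = low C.
  apply/setP => B; rewrite !inE; have [->|nB] := eqVneq B (W C).
    by rewrite sub_mW !andbF.
  by rewrite in_toggle.
have WT C : W (toggle (W C) C) = W C by rewrite {1}/W lowT.
apply: (@sum_involution _ _ _ (fun C => toggle (W C) C)) => C chV.
- rewrite toggle_sub ?WV //; case/andP: chV => /is_chainP ch ->; rewrite andbT.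
  have cmp B : B \in C -> B \subset W C \/ W C \subset B.
    move=> BC; have [mB|mB] := boolP (m \subset B); [right|left].
      rewrite subUset mB andbT; apply/bigcupsP => B'; rewrite inE => /andP[B'C mB'].
      have [//|sBB'] := ch _ _ B'C BC.
      by case/negP: mB'; apply: subset_trans sBB'.
    by apply: (subset_trans _ (subsetUl _ _)); apply: bigcup_sup; rewrite inE BC.
  apply/is_chainP => A B.
  have [->|nA] := eqVneq A (W C).
    have [->|nB] := eqVneq B (W C); first by left.
    by rewrite (in_toggle _ nB) => _ /cmp[]; [right|left].
  rewrite (in_toggle _ nA) => AC.
  have [->|nB] := eqVneq B (W C); first by case: (cmp _ AC); [left|right].
  by rewrite in_toggle //; apply: ch.
- by rewrite WT toggleK.
- by rewrite toggle_sign.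
Qed.

(** The coefficient of [D] once the condition that a chain [C] lies in [V] is expanded by
    inclusion-exclusion over the subsets [D] of [C] disjoint from [V]. *)
Definition chain_coef D : int :=
  (-1) ^+ #|D| * \sum_(C | is_chain C && (D \subset C)) (-1) ^+ #|C|.

Lemma chain_expansion V :
    (V != set0 -> exists2 m, m \in V & forall A, A \in V -> A :|: m \in V) ->
  (V == set0)%:R = \sum_(D | is_chain D) chain_coef D * [disjoint D & V]%:R.
Proof.
move=> hV.
have -> : (V == set0)%:R =
    \sum_(C | is_chain C) (-1) ^+ #|C| * (C :\: V == set0)%:R :> int.
  transitivity (\sum_(C | is_chain C && (C \subset V)) (-1) ^+ #|C| : int).
    have [->|/hV[m mV Vm]] := eqVneq V set0; last first.
      by rewrite (sum_chains_contractible mV).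
    rewrite (big_pred1 set0) ?cards0 ?expr0 // => C.
    rewrite subset0 andbC /=; have [->|//] := eqVneq C set0.
    by apply/is_chainP => A B; rewrite inE.
  rewrite big_mkcondr /=; apply: eq_bigr => C _; rewrite setD_eq0.
  by case: (C \subset V); rewrite ?mulr1 ?mulr0.
transitivity (\sum_(C | is_chain C) \sum_(D | is_chain D && (D \subset C))
    (-1) ^+ #|C| * ((-1) ^+ #|D| * [disjoint D & V]%:R) : int).
  apply: eq_bigr => C ch; rewrite -mulr_sumr -sum_subsets_sign; congr (_ * _).
  rewrite big_mkcond [RHS]big_mkcond /=; apply: eq_bigr => D _.
  rewrite subsetD; have [sDC|] := boolP (D \subset C); last by rewrite andbF.
  by rewrite (is_chainS sDC ch) /=; case: ifP; rewrite ?mulr1 ?mulr0.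
rewrite (exchange_big_dep (@is_chain T)) /=; last by move=> C D _ /andP[].
apply: eq_bigr => D chD; rewrite /chain_coef mulr_sumr mulr_suml.
apply: eq_big => C; first by rewrite chD.
by move=> _; rewrite mulrA [_ * (-1) ^+ #|D|]mulrC.
Qed.

End ChainSums.

Section NestedExpansion.
Variables (R : realType) (T : finType) (M : matroid T).
Implicit Types (x : {ffun T -> R}) (D : {set {set T}}).

Lemma chain_nested_matroid D : is_chain D -> exists K : matroid T,
  [/\ nested K, rk K = rk M & forall x, base_polytope K x <->
      [/\ forall e, 0 <= x e <= 1, \sum_e x e = (rk M)%:R &
       forall A, A \in D -> \sum_(e in A) x e <= (rank M A)%:R]].
Proof.
move=> /is_chainP chD; pose C := [set: T] |: D.
have chC : is_chain C.
  apply/is_chainP => A B; rewrite !inE => /orP[/eqP->|AD]; first by right; apply: subsetT.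
  by case/orP=> [/eqP->|]; [left; apply: subsetT | apply: chD].
have TC : [set: T] \in C by rewrite !inE eqxx.
have rkK : rk (chain_matroid (rank M) chC) = rk M.
  apply/eqP; rewrite eqn_leq chain_matroid_rank //=.
  have [B [iB _ cB]] := rank_witness M [set: T].
  rewrite [X in (X <= _)%N]/rk -cB; apply: indep_le_rank; last exact: subsetT.
  rewrite inE; apply/forall_inP => A _; rewrite indep_le_rank ?subsetIr //.
  exact: indepS (subsetIl _ _) iB.
exists (chain_matroid (rank M) chC); split=> // [|x]; first exact: chain_matroid_nested.
apply: (iff_trans (@base_polytope_facets R T _ C (rank M) _ TC _ x)).
- by move=> B; apply/basisP/andP; rewrite inE rkK => -[h1 h2]; split=> //; apply/eqP.
- move=> {}x A B _ AC BC tA tB; have [/setIidPl|/setIidPr] := is_chainP _ chC _ _ AC BC.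
    by move->.
  by move->.
split=> -[x01 h1 h2]; split=> // A; first by move=> AD; apply: h1; rewrite !inE AD orbT.
by rewrite !inE => /orP[/eqP->|/h2 //]; rewrite (eq_bigl _ _ (in_setT (T:=T))) h1.
Qed.

Lemma nested_expansion : exists (K : {set {set T}} -> matroid T),
  (forall D, is_chain D -> nested (K D) /\ rk (K D) = rk M) /\
  forall x, (\1_(base_polytope M) x : R) =
    \sum_(D | is_chain D) (chain_coef D)%:~R * \1_(base_polytope (K D)) x.
Proof.
have /choice[K hK] : forall D, exists K : matroid T, is_chain D ->
    [/\ nested K, rk K = rk M & forall x, base_polytope K x <->
      [/\ forall e, 0 <= x e <= 1, \sum_e x e = (rk M)%:R &
       forall A, A \in D -> \sum_(e in A) x e <= (rank M A)%:R]].
  move=> D; have [/chain_nested_matroid[K hK]|_] := boolP (is_chain D).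
    by exists K.
  by exists M.
exists K; split=> [D /hK[] // | x].
have [[x01 xT]|nx] := pselect ((forall e, 0 <= x e <= 1) /\ \sum_e x e = (rk M)%:R); last first.
  rewrite indicE memNset => [|/base_polytope_rank[? _ ?]]; last exact: nx.
  rewrite big1 // => D /hK[_ _ KP].
  by rewrite indicE memNset ?mulr0 // => /KP[? ? _]; apply: nx.
pose V := [set A : {set T} | (rank M A)%:R < \sum_(e in A) x e].
have -> : \1_(base_polytope M) x = (V == set0)%:R :> R.
  rewrite indicE; congr ((nat_of_bool _)%:R).
  apply/idP/eqP => [/set_mem/base_polytope_rank[_ xr _]|V0].
    by apply/setP => A; rewrite !inE ltNge xr.
  apply/mem_set/base_polytope_rank; split=> // A.
  by have := in_set0 A; rewrite -V0 inE ltNge => /negbFE.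
have KV D : is_chain D -> \1_(base_polytope (K D)) x = [disjoint D & V]%:R :> R.
  move=> /hK[_ _ KP]; rewrite indicE; congr ((nat_of_bool _)%:R).
  apply/idP/idP => [/set_mem/KP[_ _ xD]|].
    by rewrite disjoint_subset; apply/subsetP => A AD; rewrite !inE ltNge xD.
  rewrite disjoint_subset => /subsetP h; apply/mem_set/KP; split=> // A /h.
  by rewrite !inE ltNge negbK.
rewrite (eq_bigr (fun D => (chain_coef D * [disjoint D & V]%:R)%:~R)); last first.
  by move=> D ch; rewrite KV // intrM; case: [disjoint D & V].
rewrite -(rmorph_sum (intmul 1)) /= -chain_expansion; first by case: (V == set0).
case/set0Pn => A0; rewrite inE => A0V.
pose f (A : {set T}) := \sum_(e in A) x e - (rank M A)%:R.
have [m _ maxm] := @arg_maxP _ _ _ A0 predT f isT.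
have f_pos A : (A \in V) = (0 < f A) by rewrite inE subr_gt0.
exists m; first by rewrite f_pos (lt_le_trans _ (maxm A0 isT)) // -f_pos inE.
(* [f] is supermodular and maximal at [m], so [f (A :|: m) >= f A + f m - f (A :&: m) >= f A >
   0]. *)
move=> A; rewrite !f_pos => fA; apply: lt_le_trans fA _.
have : f (A :&: m) <= f m := maxm _ isT; have := sum_setUI x A m.
have := rank_submod M A m; rewrite -(ler_nat R) !natrD /f; lra.
Qed.

End NestedExpansion.

(** * Euler characteristic of polyhedra *)

Section Intervals.
Variable R : realFieldType.

Lemma seq_upper (L : seq R) : exists t : R, forall l : R, l \in L -> l <= t.
Proof.
elim: L => [|a L [t ht]]; first by exists 0.
exists (Num.max a t) => l; rewrite inE => /orP[/eqP->|/ht lt]; rewrite le_max ?lexx //.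
by rewrite lt orbT.
Qed.

Lemma seq_between (L U : seq R) : (forall l u : R, l \in L -> u \in U -> l <= u) ->
  exists t : R, (forall l : R, l \in L -> l <= t) /\ (forall u : R, u \in U -> t <= u).
Proof.
case: U => [|a U] h; first by have [t ht] := seq_upper L; exists t.
have [m mU hm] := seq_min a U; exists m; split=> // l lL; exact: h.
Qed.

(** An unsatisfiable system becomes an interval with [u < l], such as the one from 1 to 0 produced
    by a false constant constraint. *)
Lemma halflines_interval (s : seq (R * R)) : exists (l u : R), forall t : R,
  (0 <= t <= 1) && all (fun c : R * R => c.1 * t <= c.2) s = (l <= t <= u).
Proof.
elim: s => [|[a b] s [l [u IH]]].
  by exists 0, 1 => t; rewrite andbT.
have [a0|a0|a0] := ltrgtP a 0.
- exists (Num.max l (b / a)), u => t.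
  rewrite /= andbCA IH ge_max ler_ndivrMr // [t * a]mulrC.
  by rewrite andbCA andbA.
- exists l, (Num.min u (b / a)) => t.
  rewrite /= andbCA IH le_min ler_pdivlMr // [t * a]mulrC.
  by rewrite [RHS]andbA andbC.
- have [b0|b0] := leP 0 b.
    by exists l, u => t; rewrite /= a0 mul0r b0 /= IH.
  by exists 1, 0 => t; rewrite /= a0 mul0r (lt_geF b0) /= andbF; apply/esym/negP; lra.
Qed.

(* The value of an indicator of a closed interval minus its right limit is the
   indicator of the right endpoint. *)
Lemma sum_intervals (I : finType) (c l u : I -> R) :
    (forall t : R, \sum_i c i * (l i <= t <= u i)%R%:R = 0) ->
  \sum_i c i * (l i <= u i)%R%:R = 0.
Proof.
move=> h.
have jump b : \sum_i c i * ((l i <= b)%R && (u i == b))%:R = 0.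
  (* No endpoint lies strictly between [b] and the minimum [m] chosen next, so the midpoint [t]
     represents the right limit at [b]. *)
  pose s := [seq z <- [seq l i | i <- enum I] ++ [seq u i | i <- enum I] | b < z].
  have [m ms hm] := seq_min (b + 1) s.
  have bm : b < m.
    move: ms; rewrite inE => /orP[/eqP->|]; first by rewrite ltrDl.
    by rewrite mem_filter => /andP[].
  pose t := (b + m) / 2.
  have bt : b < t by rewrite /t; lra.
  have tl i : b < l i -> t < l i.
    move=> bl; have : m <= l i; last by rewrite /t; lra.
    by rewrite hm // inE mem_filter bl mem_cat (map_f l) ?orbT // mem_enum.
  have tu i : b < u i -> t < u i.
    move=> bu; have : m <= u i; last by rewrite /t; lra.
    by rewrite hm // inE mem_filter bu mem_cat (map_f u) ?orbT // mem_enum.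
  rewrite -[RHS](subrr 0) -[X in X - _](h b) -[X in _ - X](h t) -sumrB.
  apply: eq_bigr => i _.
  rewrite -mulrBr; congr (_ * _).
  have [ub|bu|ub] := ltrgtP (u i) b.
  - by rewrite (lt_geF (lt_trans ub bt)) !andbF subrr.
  - have -> : (t <= u i) = true by rewrite ltW // tu.
    rewrite !andbT andbF; have [lb|/tl lt] := leP (l i) b.
      by rewrite (le_trans lb (ltW bt)) subrr.
    by rewrite (lt_geF lt) subrr.
  - by rewrite ub (lt_geF bt) andbF subr0 !andbT.
pose us := undup [seq u i | i <- enum I].
transitivity (\sum_(b <- us) \sum_i c i * ((l i <= b)%R && (u i == b))%:R).
  rewrite exchange_big /=; apply: eq_bigr => i _.
  rewrite -mulr_sumr (bigD1_seq (u i)) ?undup_uniq //=; last first.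
    by rewrite mem_undup map_f // mem_enum.
  rewrite eqxx andbT big1 ?addr0 // => b; rewrite eq_sym => /negPf->.
  by rewrite andbF.
by rewrite big1.
Qed.

End Intervals.

(** * Polyhedra and their coordinate projections *)

Section Polyhedra.
Variables (R : realFieldType) (T : finType).
Local Notation V := {ffun T -> R}.
Implicit Types (x y : V) (s : seq (V * R)) (P Q : V -> Prop).

Definition dot x y := \sum_e x e * y e.
Definition sat s x := all (fun c => dot c.1 x <= c.2) s.
Definition polyhedral P := exists s, forall x, sat s x <-> P x.
Definition upd x e t : V := [ffun e' => if e' == e then t else x e'].

Lemma dot_upd a x e t : dot a (upd x e t) = dot a (upd x e 0) + a e * t.
Proof.
rewrite /dot (bigD1 e) //= [in RHS](bigD1 e) //= !ffunE eqxx mulr0 add0r addrC.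
by congr (_ + _); apply: eq_bigr => e' /negPf ne; rewrite !ffunE ne.
Qed.

Lemma upd_id x e : upd x e (x e) = x.
Proof. by apply/ffunP => e'; rewrite ffunE; case: eqP => [->|]. Qed.

Lemma dot_split a x e : dot a x = dot a (upd x e 0) + a e * x e.
Proof. by rewrite -dot_upd upd_id. Qed.

Lemma updK x e t t' : upd (upd x e t) e t' = upd x e t'.
Proof. by apply/ffunP => e'; rewrite !ffunE; case: eqP. Qed.

Lemma polyhedral_line s x e : (forall y, sat s y -> 0 <= y e <= 1) ->
  exists (l u : R), forall t : R, sat s (upd x e t) = (l <= t <= u).
Proof.
move=> h.
have [l [u hlu]] := halflines_interval
  [seq (c.1 e, c.2 - dot c.1 (upd x e 0)) | c : V * R <- s].
exists l, u => t; rewrite -hlu all_map.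
have -> : all (preim (fun c : V * R => (c.1 e, c.2 - dot c.1 (upd x e 0)))
    (fun c : R * R => c.1 * t <= c.2)) s = sat s (upd x e t).
  by rewrite /sat; apply: eq_in_all => c _; rewrite dot_upd /= lerBrDl; exact: erefl.
have [/h|] := boolP (sat s (upd x e t)); last by rewrite andbF.
by rewrite ffunE eqxx => ->.
Qed.

(* Fourier-Motzkin elimination of the coordinate e. *)
Lemma polyhedral_proj s e :
  exists s', forall x, sat s' x <-> exists t, sat s (upd x e t).
Proof.
pose pos := [seq c : V * R <- s | 0 < c.1 e].
pose neg := [seq c : V * R <- s | c.1 e < 0].
(* The combination of an upper and a lower bound on coordinate [e], with positive weights, in which
   [e] cancels. *)
pose comb (p n : V * R) : V * R :=
  ([ffun e' => p.1 e' * - n.1 e + n.1 e' * p.1 e], p.2 * - n.1 e + n.2 * p.1 e).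
have dot_comb p n x : dot (comb p n).1 x = dot p.1 x * - n.1 e + dot n.1 x * p.1 e.
  rewrite /dot !mulr_suml -big_split; apply: eq_bigr => e' _.
  by rewrite ffunE /= mulrDl mulrAC [_ * _ * x e']mulrAC.
exists ([seq c : V * R <- s | c.1 e == 0] ++ [seq comb p n | p <- pos, n <- neg]) => x.
rewrite /sat all_cat all_filter; split=> [/andP[/allP hz /allP hc]|[t /allP ht]].
  pose bnd (c : V * R) := (c.2 - dot c.1 (upd x e 0)) / c.1 e.
  have [|t [tl tu]] := @seq_between R (map bnd neg) (map bnd pos).
    move=> _ _ /mapP[n nN ->] /mapP[p pP ->]; rewrite /bnd.
    move: (nN) (pP); rewrite !mem_filter => /andP[n0 _] /andP[p0 _].
    have := hc (comb p n) (allpairs_f _ pP nN).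
    rewrite (dot_split _ x e) dot_comb /= ffunE.
    have -> : p.1 e * - n.1 e + n.1 e * p.1 e = 0 by rewrite mulrN mulrC addNr.
    rewrite mul0r addr0 => le.
    rewrite ler_ndivrMr // mulrAC ler_pdivrMr //.
    by move: le; set a := dot _ _; set b := dot _ _; lra.
  exists t; apply/allP => c cs; rewrite dot_upd.
  have [c0|c0|c0] := ltrgtP (c.1 e) 0.
  - have /tl : bnd c \in map bnd neg by rewrite map_f // mem_filter c0.
    by rewrite /bnd ler_ndivrMr // lerBrDl mulrC.
  - have /tu : bnd c \in map bnd pos by rewrite map_f // mem_filter c0.
    by rewrite /bnd ler_pdivlMr // lerBrDl mulrC.
  - have := hz c cs; by rewrite /= c0 eqxx (dot_split _ x e) c0 !mul0r.
apply/andP; split.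
  apply/allP => c cs; apply/implyP => /eqP c0; have := ht c cs.
  by rewrite (dot_split _ x e) dot_upd c0 !mul0r.
apply/allP => _ /allpairsP[[p n] /= [pP nN ->]].
move: pP nN; rewrite !mem_filter => /andP[p0 ps] /andP[n0 ns].
have -> : dot (comb p n).1 x = dot (comb p n).1 (upd x e t).
  rewrite (dot_split _ x e) [RHS]dot_upd /= ffunE.
  have -> : p.1 e * - n.1 e + n.1 e * p.1 e = 0 by rewrite mulrN mulrC addNr.
  by rewrite !mul0r.
rewrite dot_comb /=; apply: lerD.
  by rewrite ler_wpM2r ?ht // oppr_ge0 ltW.
by rewrite ler_wpM2r ?ht // ltW.
Qed.

Lemma polyhedral_and P Q : polyhedral P -> polyhedral Q ->
  polyhedral (fun x => P x /\ Q x).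
Proof.
move=> [s hs] [s' hs']; exists (s ++ s') => x.
by rewrite /sat all_cat; split=> [/andP[/hs ? /hs' ?]|[/hs ? /hs' ?]] //; apply/andP.
Qed.

Lemma polyhedral_forall (I : finType) (P : I -> V -> Prop) :
  (forall i, polyhedral (P i)) -> polyhedral (fun x => forall i, P i x).
Proof.
move=> /choice[s hs]; exists (flatten [seq s i | i <- enum I]) => x.
split=> [/allP h i|h].
  apply/hs/allP => c cs; apply: h; apply/flattenP.
  by exists (s i) => //; rewrite map_f // mem_enum.
by apply/allP => c /flattenP[_ /mapP[i _ ->]]; move: c; apply/allP/hs.
Qed.

Lemma polyhedral_ext P Q : (forall x, P x <-> Q x) -> polyhedral P -> polyhedral Q.
Proof. by move=> PQ [s hs]; exists s => x; apply: iff_trans (PQ x). Qed.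

Lemma polyhedral_sum_le (A : {set T}) k : polyhedral (fun x => \sum_(e in A) x e <= k).
Proof.
exists [:: ([ffun e => (e \in A)%:R], k)] => x; rewrite /sat /= andbT /dot.
suff -> : \sum_e [ffun e => (e \in A)%:R] e * x e = \sum_(e in A) x e by [].
rewrite [RHS]big_mkcond; apply: eq_bigr => e _; rewrite ffunE.
by case: (e \in A); rewrite ?mul1r ?mul0r.
Qed.

Lemma polyhedral_sum_ge (A : {set T}) k : polyhedral (fun x => k <= \sum_(e in A) x e).
Proof.
exists [:: ([ffun e => - (e \in A)%:R], - k)] => x; rewrite /sat /= andbT /dot.
suff -> : \sum_e [ffun e => - (e \in A)%:R] e * x e = - \sum_(e in A) x e.
  by rewrite lerN2.
rewrite -sumrN [RHS]big_mkcond; apply: eq_bigr => e _; rewrite ffunE.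
by case: (e \in A); rewrite ?mulN1r ?oppr0 ?mul0r.
Qed.

Variables (I : finType) (c : I -> R).

(** On a line in direction [e] the polyhedra become closed intervals, so a linear relation between
    their indicators passes to the indicators of their projections. *)
Lemma sum_line (s : I -> seq (V * R)) e x :
    (forall i y, sat (s i) y -> 0 <= y e <= 1) ->
    (forall y, \sum_i c i * (sat (s i) y)%:R = 0) ->
  \sum_i c i * `[< exists t : R, sat (s i) (upd x e t) >]%:R = 0.
Proof.
move=> bnd h.
have /choice[lu hlu] : forall i, exists lu, forall t,
    sat (s i) (upd x e t) = (lu.1 <= t <= lu.2).
  by move=> i; have [l [u hlu]] := polyhedral_line x (bnd i); exists (l, u).
rewrite -[RHS](@sum_intervals R I c (fun i => (lu i).1) (fun i => (lu i).2)).
  apply: eq_bigr => i _; congr (_ * (nat_of_bool _)%:R); apply/asboolP/idP.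
    by case=> t; rewrite hlu => /andP[]; apply: le_trans.
  by move=> le; exists (lu i).1; rewrite hlu lexx.
by move=> t; rewrite -[RHS](h (upd x e t)); apply: eq_bigr => i _; rewrite hlu.
Qed.

Lemma sum_proj (es : seq T) : uniq es -> forall s : I -> seq (V * R),
    (forall i y e, e \in es -> sat (s i) y -> 0 <= y e <= 1) ->
    (forall y, \sum_i c i * (sat (s i) y)%:R = 0) ->
  forall x, \sum_i c i *
    `[< exists2 y : V, (forall e, e \notin es -> y e = x e) & sat (s i) y >]%:R = 0.
Proof.
elim: es => [_ s _ h x|e es IH /= /andP[e_es u_es] s bnd h x].
  rewrite -[RHS](h x); apply: eq_bigr => i _; congr (_ * (nat_of_bool _)%:R).
  apply/asboolP/idP => [[y yx]|sx]; last by exists x.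
  by have -> : y = x by apply/ffunP => e; apply: yx.
have /choice[s' hs'] := fun i => polyhedral_proj (s i) e.
rewrite -[RHS](IH u_es s' _ _ x) => [|i y e' e'es|y].
- apply: eq_bigr => i _; congr (_ * (nat_of_bool _)%:R); apply: asbool_equiv_eq.
  split=> [[y yx sy]|[y yx /hs'[t sy]]].
    exists (upd y e (x e)) => [e' e'es|].
      by rewrite ffunE; case: eqP => [->//|/eqP ne]; rewrite yx // inE negb_or ne.
    by apply/hs'; exists (y e); rewrite updK upd_id.
  exists (upd y e t) => // e'; rewrite inE negb_or ffunE => /andP[/negPf-> ?].
  exact: yx.
- move/hs'=> [t /(bnd _ _ e')]; rewrite inE e'es orbT ffunE => /(_ isT).
  by case: eqP => // e'e; rewrite -e'e e'es in e_es.
rewrite -[RHS](sum_line (s := s) (e := e) y) //; last first.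
  by move=> i z; apply: bnd; rewrite inE eqxx.
apply: eq_bigr => i _; congr (_ * (nat_of_bool _)%:R).
by apply/idP/asboolP => /hs'.
Qed.

(** Nonemptiness is the Euler characteristic of a compact polyhedron; projecting away one coordinate
    after the other reduces it to a point. *)
Lemma sum_nonempty (P : I -> V -> Prop) :
    (forall i, polyhedral (P i)) -> (forall i x e, P i x -> 0 <= x e <= 1) ->
    (forall x, \sum_i c i * `[< P i x >]%:R = 0) ->
  \sum_i c i * `[< exists x : V, P i x >]%:R = 0.
Proof.
move=> /choice[s hs] bnd h.
rewrite -[RHS](sum_proj (enum_uniq T) (s := s) _ _ [ffun=> 0]).
- apply: eq_bigr => i _; congr (_ * (nat_of_bool _)%:R); apply: asbool_equiv_eq.
  split=> [[x /hs sx]|[x _ /hs Px]]; last by exists x.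
  by exists x => // e; rewrite mem_enum.
- by move=> i y e _ /hs; apply: bnd.
move=> y; rewrite -[RHS](h y); apply: eq_bigr => i _; congr (_ * (nat_of_bool _)%:R).
by apply/idP/asboolP => /hs.
Qed.

End Polyhedra.

(** * Rank sequences are valuative *)

Section RankSequence.
Variable T : finType.
Implicit Types (M : matroid T) (s : {perm T}).

Notation rank_sequence := {ffun 'I_#|T|.+1 -> 'I_#|T|.+1}.

(** Values in an ordinal type make rank sequences a finite type to sum over; [inord] loses nothing,
    as ranks are at most [#|T|]. *)
Definition rkseq M s : rank_sequence := [ffun k : 'I_#|T|.+1 => inord (rank M (segment s k))].

Lemma rkseqE M s k : rkseq M s k = rank M (segment s k) :> nat.
Proof.
by rewrite ffunE inordK // ltnS (leq_trans (rank_le_card _ _)) // max_card.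
Qed.

Variable R : realType.
Implicit Types (x : {ffun T -> R}).

(** The rank bounds on all initial segments are attained at once by a greedily chosen basis, whose
    permuted characteristic vector is the required point. *)
Lemma permuted_polytope_rank M s (t : rank_sequence) :
  (exists x, rank_bounded M [ffun e => x (s e)] /\
     forall k : 'I_#|T|.+1, (t k)%:R <= \sum_(e in [set e | (enum_rank e < k)%N]) x e)
  <-> forall k, (t k <= rkseq M s k)%N.
Proof.
have sumE x (k : 'I_#|T|.+1) : \sum_(e in [set e | (enum_rank e < k)%N]) x e =
    \sum_(e in segment s k) [ffun e => x (s e)] e :> R.
  rewrite (reindex_inj (@perm_inj _ s)) /=; apply: eq_big => e; rewrite ?inE //.
  by rewrite ffunE.
split=> [[x [[_ xr _] hx]] k|ht].
  by rewrite rkseqE -(ler_nat R) (le_trans (hx k)) // sumE xr.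
have [B bB hB] := @chain_basis _ M (segment s) #|T|
  (fun k => segmentS s (leqnSn k)) (segmentT s).
pose x := [ffun e => char_vec R B ((s^-1)%g e)].
have xs : [ffun e => x (s e)] = char_vec R B.
  by apply/ffunP => e; rewrite !ffunE permK.
exists x; rewrite xs; split.
  apply/base_polytope_rank/base_polytopeP; exists (fun B' => (B' == B)%:R).
  have sumB (f : {set T} -> R) : \sum_B' (B' == B)%:R * f B' = f B.
    rewrite (bigD1 B) //= eqxx mul1r big1 ?addr0 // => B' /negPf->.
    by rewrite mul0r.
  split=> [B'|B'||e]; first by rewrite ler0n.
  - by have [->|_] := eqVneq B' B; rewrite ?eqxx.
  - by rewrite -[RHS](sumB (fun=> 1)); apply: eq_bigr => B' _; rewrite mulr1.
  - by rewrite sumB ffunE.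
move=> k; rewrite sumE xs char_vec_sum hB; last by rewrite -ltnS.
by rewrite ler_nat -rkseqE.
Qed.

Variables (J : finType) (c : J -> R) (M : J -> matroid T).
Hypothesis h : forall x, \sum_j c j * sym_indic (base_polytope (M j)) x = 0.

Lemma sum_perm_polytope x :
  \sum_j \sum_(s : {perm T}) c j * `[< rank_bounded (M j) [ffun e => x (s e)] >]%:R = 0.
Proof.
have fact_neq0 : ((#|T|)`!%:R)^-1 != 0 :> R.
  by rewrite invr_eq0 pnatr_eq0 -lt0n fact_gt0.
apply: (mulfI fact_neq0); rewrite mulr0 -[RHS](h x) mulr_sumr; apply: eq_bigr => j _.
rewrite /sym_indic mulrCA -mulr_sumr; congr (_ * (_ * _)).
apply: eq_bigr => s _; rewrite indicE; congr ((nat_of_bool _)%:R).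
by apply/asboolP/idP => [/base_polytope_rank/mem_set|/set_mem/base_polytope_rank].
Qed.

Lemma sum_rkseq_ge (t : rank_sequence) :
  \sum_j c j * (\sum_(s : {perm T}) [forall k, t k <= rkseq (M j) s k]%N%:R) = 0.
Proof.
pose P (p : J * {perm T}) x := rank_bounded (M p.1) [ffun e => x (p.2 e)] /\
  forall k : 'I_#|T|.+1, (t k)%:R <= \sum_(e in [set e | (enum_rank e < k)%N]) x e.
transitivity (\sum_(p : J * {perm T}) c p.1 * `[< exists x, P p x >]%:R).
  rewrite -(pair_bigA _ (fun j s => c j * `[< exists x, P (j, s) x >]%:R)) /=.
  apply: eq_bigr => j _; rewrite mulr_sumr; apply: eq_bigr => s _.
  congr (_ * (nat_of_bool _)%:R); apply/forallP/asboolP.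
    by move=> ht; apply/permuted_polytope_rank.
  by move/permuted_polytope_rank.
apply: sum_nonempty.
- move=> [j s]; apply: polyhedral_and; last first.
    by apply: polyhedral_forall => k; apply: polyhedral_sum_ge.
  have sumE x (A : {set T}) : \sum_(e in A) [ffun e => x (s e)] e =
      \sum_(e in s @: A) x e.
    rewrite big_imset /=; last by move=> ? ? _ _; apply: perm_inj.
    by apply: eq_bigr => e _; rewrite ffunE.
  have bound (A : {set T}) (k : nat) :
      polyhedral (fun x => \sum_(e in A) [ffun e => x (s e)] e <= k%:R).
    apply: polyhedral_ext (polyhedral_sum_le (s @: A) k%:R) => x.
    by rewrite sumE.
  have bound' (A : {set T}) (k : nat) :
      polyhedral (fun x => k%:R <= \sum_(e in A) [ffun e => x (s e)] e).
    apply: polyhedral_ext (polyhedral_sum_ge (s @: A) k%:R) => x.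
    by rewrite sumE.
  apply: polyhedral_ext (polyhedral_and (polyhedral_forall
    (fun e => polyhedral_and (bound' [set e] 0%N) (bound [set e] 1%N)))
    (polyhedral_and (polyhedral_forall (fun A => bound A (rank (M j) A)))
      (polyhedral_and (bound [set: T] (rk (M j))) (bound' [set: T] (rk (M j)))))).
  move=> x; rewrite /rank_bounded /= (eq_bigl _ _ (in_setT (T:=T))).
  split=> [[h1 [h2 [h3 h4]]]|[h1 h2 h3]].
    split=> // [e|]; first by have := h1 e; rewrite big_set1 => -[-> ->].
    by apply/eqP; rewrite eq_le h3 h4.
  split=> [e|]; first by rewrite big_set1; apply/andP; apply: h1.
  by split=> //; rewrite h3.
- move=> [j s] x e [[x01 _ _] _].
  by have := x01 ((s^-1)%g e); rewrite ffunE permKV.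
move=> x; rewrite -(pair_bigA _ (fun j s => c j * `[< P (j, s) x >]%:R)) /=.
(* The fixed polyhedron does not depend on [j] and [s]: inside it the relation is the one between
   the permuted polytopes, outside it every term vanishes. *)
have [ht|nt] := pselect (forall k : 'I_#|T|.+1,
    (t k)%:R <= \sum_(e in [set e | (enum_rank e < k)%N]) x e).
  rewrite -[RHS](sum_perm_polytope x); apply: eq_bigr => j _; apply: eq_bigr => s _.
  by congr (_ * (nat_of_bool _)%:R); apply: asbool_equiv_eq; split=> [[]|].
rewrite big1 // => j _; rewrite big1 // => s _.
by rewrite asboolF ?mulr0 // => -[_ /nt].
Qed.

(** Downward induction on the total of [t]: the count of sequences at least [t] is the sum of the
    counts for all [u >= t], and every [u] other than [t] already cancels by induction. *)
Lemma sum_rkseq_eq (t : rank_sequence) :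
  \sum_j c j * (\sum_(s : {perm T}) (rkseq (M j) s == t)%:R) = 0.
Proof.
pose D (t : rank_sequence) := \sum_j c j * (\sum_(s : {perm T}) (rkseq (M j) s == t)%:R).
pose wt (t : rank_sequence) := (\sum_k t k)%N.
have [n] := ubnP (#|T|.+1 * #|T|.+1 - wt t); elim: n t => // n IH t; rewrite ltnS => le_n.
have wt_le (u : rank_sequence) : (wt u <= #|T|.+1 * #|T|.+1)%N.
  rewrite -[X in (_ <= X * _)%N]card_ord -sum_nat_const leq_sum // => k _.
  exact: ltnW.
rewrite -[RHS](sum_rkseq_ge t).
transitivity (\sum_(u : rank_sequence | [forall k, t k <= u k]%N) D u).
  rewrite (bigD1 t) /=; last by apply/forallP.
  rewrite [X in _ = _ + X]big1 ?addr0 // => u /andP[/forallP tu ut].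
  have ltw : (wt t < wt u)%N.
    have [k tk] : exists k, t k != u k.
      apply/existsP; apply: contraNT ut; rewrite negb_exists => /forallP tu'.
      by apply/eqP/ffunP => k; have := tu' k; rewrite negbK => /eqP.
    rewrite /wt (bigD1 k) //= [X in (_ < X)%N](bigD1 k) //= -addSn leq_add //.
      by rewrite ltn_neqAle tu andbT.
    by apply: leq_sum => k' _; apply: tu.
  apply: IH; apply: leq_trans le_n; rewrite ltn_sub2l //.
  exact: leq_trans ltw (wt_le u).
rewrite /D exchange_big /=; apply: eq_bigr => j _; rewrite -mulr_sumr; congr (_ * _).
rewrite exchange_big /=; apply: eq_bigr => s _.
have [ts|nts] := boolP [forall k, t k <= rkseq (M j) s k]%N.
  rewrite (bigD1 (rkseq (M j) s)) //= eqxx big1 ?addr0 // => u /andP[_].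
  by rewrite eq_sym => /negPf->.
by rewrite big1 // => u tu; case: eqP nts tu => // -> /negPf->.
Qed.

Lemma valuative_rkseq (l : rank_sequence -> R) :
  \sum_j c j * (\sum_(s : {perm T}) l (rkseq (M j) s)) = 0.
Proof.
transitivity (\sum_(t : rank_sequence)
    (\sum_j c j * (\sum_(s : {perm T}) (rkseq (M j) s == t)%:R)) * l t); last first.
  by rewrite big1 // => t _; rewrite sum_rkseq_eq mul0r.
under [RHS]eq_bigr do rewrite mulr_suml.
rewrite exchange_big /=; apply: eq_bigr => j _.
under [RHS]eq_bigr do rewrite -mulrA mulr_suml.
rewrite -mulr_sumr exchange_big /=; congr (_ * _); apply: eq_bigr => s _.
rewrite (bigD1 (rkseq (M j) s)) //= eqxx mul1r big1 ?addr0 // => t.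
by rewrite eq_sym => /negPf->; rewrite mul0r.
Qed.

End RankSequence.

(** * Independence of nested matroids *)

Section CyclicFlats.
Variables (T : finType) (M : matroid T).
Implicit Types (A F I X : {set T}).

Lemma dep_circuit A : A \notin indep M -> exists2 X, circuit M X & X \subset A.
Proof.
move=> nA; have [X mX sX] := @minset_exists _ (fun I => I \notin indep M) A nA.
by exists X.
Qed.

Lemma circuit_dep X : circuit M X -> X \notin indep M.
Proof. by case/minsetP. Qed.

Lemma circuit_del X x : circuit M X -> x \in X -> X :\ x \in indep M.
Proof.
case/minsetP=> _ minX xX; apply: contraT => /minX/(_ (subsetDl _ _)) e.
by move: xX; rewrite -e !inE eqxx.
Qed.

Lemma rank_circuit X x : circuit M X -> x \in X -> rank M X = #|X :\ x|.
Proof.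
move=> cX xX; apply/eqP; rewrite eqn_leq indep_le_rank ?subsetDl ?circuit_del // andbT.
have := cardsD1 x X; rewrite xX add1n -ltnS => <-; rewrite ltnNge.
exact: contra (@rank_card_indep _ M X) (circuit_dep cX).
Qed.

Lemma circuit_neq0 X : circuit M X -> exists x, x \in X.
Proof.
move=> cX; apply/set0Pn; apply: contraNneq (circuit_dep cX) => ->.
exact: indep0.
Qed.

(** For [e] in the closure outside [X] and [x] in [X], the set [e |: (X :\ x)] is dependent, and a
    circuit in it contains [e] because [X :\ x] is independent. *)
Lemma cl_circuit X : circuit M X -> cyclic_flat M (cl M X).
Proof.
move=> cX; rewrite /cyclic_flat flat_cl /=; apply/existsP.
exists [set C | circuit M C && (C \subset cl M X)].
apply/andP; split; first by apply/forall_inP => C; rewrite inE => /andP[].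
rewrite eqEsubset; apply/andP; split.
  by apply/bigcupsP => C; rewrite inE => /andP[].
apply/subsetP => e ecl; apply/bigcupP.
have [eX|eX] := boolP (e \in X); first by exists X; rewrite // inE cX sub_cl.
have [x xX] := circuit_neq0 cX.
have [|C cC sC] := @dep_circuit (e |: (X :\ x)).
  apply: contraL (ecl) => ieX; rewrite inE (rank_circuit cX xX) neq_ltn; apply/orP; right.
  apply: leq_trans (_ : #|e |: (X :\ x)| <= _)%N.
    by rewrite cardsU1 !inE (negPf eX) andbF.
  by rewrite indep_le_rank // setUS // subsetDl.
exists C.
  rewrite inE cC (subset_trans sC) // subUset sub1set ecl /=.
  by rewrite (subset_trans (subsetDl _ _)) ?sub_cl.
apply: contraT => eC; case/negP: (circuit_dep cC).
apply: indepS (circuit_del cX xX); apply/subsetP => z zC.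
have := subsetP sC z zC; rewrite !inE; case: eqP => // ze.
by rewrite ze (negPf eC) in zC.
Qed.

(** A dependent [I] contains a circuit, whose closure is a cyclic flat in which [I] exceeds the
    rank. *)
Lemma indep_cyclic_flats I :
  (forall F, cyclic_flat M F -> (#|I :&: F| <= rank M F)%N) -> I \in indep M.
Proof.
move=> hI; apply: contraT => /dep_circuit[X cX sXI].
have [x xX] := circuit_neq0 cX.
have := hI _ (cl_circuit cX); rewrite rank_cl (rank_circuit cX xX) leqNgt => /negP[].
have := cardsD1 x X; rewrite xX add1n => <-; rewrite subset_leq_card //.
by rewrite subsetI sXI sub_cl.
Qed.

Lemma rank_leD A F : (rank M A <= rank M F + #|A :\: F|)%N.
Proof.
have [I [iI sIA <-]] := rank_witness M A; rewrite -(cardsID F I) leq_add //.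
  by rewrite indep_le_rank ?subsetIr // (indepS _ iI) ?subsetIl.
by rewrite subset_leq_card // setSD.
Qed.

(** For a largest independent [I] in [A], each [a] in [A :\: I] lies in a circuit inside [a |: I].
    The closures of these circuits form a chain, whose largest member [F] contains [A :\: I] and is
    spanned by [I :&: F]. *)
Lemma nested_rank A : nested M -> rank M A = #|A| \/
  exists2 F, cyclic_flat M F & rank M A = (rank M F + #|A :\: F|)%N.
Proof.
move=> nM; have [I [iI sIA cI]] := rank_witness M A.
have [AI|/subsetPn[a0 a0A a0I]] := boolP (A \subset I).
  by left; apply/eqP; rewrite eqn_leq rank_le_card -cI subset_leq_card.
right; pose S := [set X | circuit M X & [exists a in A :\: I, X \subset a |: I]].
have SP a : a \in A -> a \notin I -> exists2 X, X \in S & a \in X.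
  move=> aA aI; have [|X cX sX] := @dep_circuit (a |: I).
    apply/negP => iaI; have /(indep_le_rank iaI) : a |: I \subset A.
      by rewrite subUset sub1set aA.
    by rewrite cardsU1 aI add1n cI ltnn.
  exists X; first by rewrite inE cX; apply/exists_inP; exists a; rewrite // inE aI.
  apply: contraT => aX; case/negP: (circuit_dep cX); apply: indepS iI.
  apply/subsetP => z zX; have := subsetP sX z zX; rewrite !inE.
  by case: eqP => // za; rewrite -za zX in aX.
have [X0 X0S _] := SP _ a0A a0I.
have ch : is_chain (cl M @: S).
  apply/is_chainP => _ _ /imsetP[X + ->] /imsetP[Y + ->].
  by rewrite !inE => /andP[/cl_circuit cX _] /andP[/cl_circuit cY _]; apply: nM.
have [_ /imsetP[X XS ->] maxF] := chain_max ch (imset_f (cl M) X0S).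
move: XS; rewrite inE => /andP[cX /exists_inP[a + sX]].
rewrite inE => /andP[aI aA]; exists (cl M X); first exact: cl_circuit.
have aX : a \in X.
  apply: contraT => aX; case/negP: (circuit_dep cX); apply: indepS iI.
  apply/subsetP => z zX; have := subsetP sX z zX; rewrite !inE.
  by case: eqP => // za; rewrite -za zX in aX.
have -> : A :\: cl M X = I :\: cl M X.
  apply/eqP; rewrite eqEsubset (setSD _ sIA) andbT; apply/subsetP => z.
  rewrite !in_setD => /andP[zX zA]; rewrite zX; apply: contraT => zI.
  have [Y YS zY] := SP _ zA zI; case/negP: zX.
  exact: subsetP (maxF _ (imset_f _ YS)) _ (subsetP (sub_cl M Y) _ zY).
rewrite -cI -(cardsID (cl M X) I); congr (_ + _)%N; apply/eqP; rewrite eqn_leq.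
rewrite indep_le_rank ?subsetIr ?(indepS _ iI) ?subsetIl //=.
rewrite rank_cl (rank_circuit cX aX) subset_leq_card // subsetI; apply/andP; split.
  apply/subsetP => z; rewrite !inE => /andP[za zX].
  by have := subsetP sX z zX; rewrite !inE (negPf za).
exact: subset_trans (subsetDl _ _) (sub_cl _ _).
Qed.

Definition adapted (s : {perm T}) : Prop :=
  forall F, cyclic_flat M F -> segment s #|F| = F.

Lemma nested_adapted : nested M -> exists s, adapted s.
Proof.
move=> nM; have [|s hs] := @chain_segment _ [set F | cyclic_flat M F].
  by apply/is_chainP => F G; rewrite !inE; apply: nM.
by exists s => F cF; apply: hs; rewrite inE.
Qed.

(** The rank on the right is [k] or [rank M F] plus the number of elements outside a cyclic flat
    [F]. The same expression bounds the rank on the left, where the segment is comparable with [F]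
    and so has as few elements outside [F] as its size allows. *)
Lemma adapted_min s s' k : nested M -> adapted s -> (k <= #|T|)%N ->
  (rank M (segment s k) <= rank M (segment s' k))%N.
Proof.
move=> nM ad kT; have [->|[F cF ->]] := nested_rank (segment s' k) nM.
  by rewrite (leq_trans (rank_le_card _ _)) // !card_segment.
apply: leq_trans (rank_leD _ F) _; rewrite leq_add2l.
have [kF|Fk] := leqP k #|F|.
  have /eqP -> : segment s k :\: F == set0.
    by rewrite setD_eq0 -(ad F cF) segmentS.
  by rewrite cards0.
have sF : F \subset segment s k by rewrite -(ad F cF) segmentS // ltnW.
rewrite cardsDS // card_segment // leq_subLR -{1}(card_segment s' kT).
by rewrite -(cardsID F (segment s' k)) leq_add2r subset_leq_card // subsetIr.
Qed.

Lemma adapted_indep s I : adapted s ->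
  (I \in indep M) = [forall k : 'I_#|T|.+1, #|I :&: segment s k| <= rank M (segment s k)]%N.
Proof.
move=> ad; apply/idP/forallP => [iI k|h].
  by rewrite indep_le_rank ?subsetIr // (indepS _ iI) ?subsetIl.
apply: indep_cyclic_flats => F cF.
have Fn : (#|F| < #|T|.+1)%N by rewrite ltnS max_card.
by have := h (Ordinal Fn); rewrite /= ad.
Qed.

End CyclicFlats.

Section NestedIndependence.
Variables (R : realType) (T : finType).

Lemma adapted_isomorphic (M N : matroid T) s s' :
  adapted M s -> adapted N s' -> rkseq M s = rkseq N s' -> isomorphic M N.
Proof.
move=> aM aN e; pose f x := (s'^-1)%g (s x).
have f_inj : injective f by move=> x y /perm_inj/perm_inj.
exists f; first exact: injF_bij.
move=> I; rewrite (adapted_indep _ aM) (adapted_indep _ aN).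
apply: eq_forallb => k; rewrite -!rkseqE e.
have -> : f @: I :&: segment s' k = f @: (I :&: segment s k).
  apply/setP => y; rewrite !inE; apply/andP/imsetP.
    case=> /imsetP[x xI ->]; rewrite permKV => xk.
    by exists x; rewrite // !inE xI.
  case=> x; rewrite !inE => /andP[xI xk] ->; rewrite permKV xk.
  by rewrite imset_f.
by rewrite card_imset.
Qed.

Variables (J : finType) (N : J -> matroid T) (d : J -> R).
Hypothesis nestedN : forall j, nested (N j).
Hypothesis isoN : forall i j, isomorphic (N i) (N j) -> i = j.

(* The rank sequence of an adapted order is the pointwise smallest one and
   determines the nested matroid, so the system is triangular. *)
Lemma nested_rkseq_independent :
  (forall l : {ffun 'I_#|T|.+1 -> 'I_#|T|.+1} -> R,
     \sum_j d j * (\sum_(s : {perm T}) l (rkseq (N j) s)) = 0) ->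
  forall j, d j = 0.
Proof.
move=> h j0; apply/eqP; apply: contraT => dj0.
have /choice[s ad] := fun j => nested_adapted (@nestedN j).
pose t j := rkseq (N j) (s j).
have [j dj minj] := @arg_minnP _ j0 (fun j => d j != 0) (fun j => \sum_k t j k)%N dj0.
(* Test on the indicator of [t j], where [j] has least total among the nonzero coefficients. Another
   such [N k] attaining this sequence would have [t k <= t j], hence [t k = t j], and would be
   isomorphic to [N j]. *)
have := h (fun u => (u == t j)%:R).
rewrite (bigD1 j) //= [X in _ + X]big1 ?addr0 => [/eqP|k kj].
  rewrite mulf_eq0 (negPf dj) (bigD1 (s j)) //= eqxx => /eqP e.
  have : 0 < 1 + \sum_(i | i != s j) (rkseq (N j) i == t j)%:R :> R.
    by rewrite ltr_pwDl // sumr_ge0.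
  by rewrite e ltxx.
have [->|dk] := eqVneq (d k) 0; first by rewrite mul0r.
rewrite big1 ?mulr0 // => s' _; case: eqP => // e.
have tkj i : (t k i <= t j i)%N.
  by rewrite -e !rkseqE adapted_min // -ltnS.
case/eqP: kj; apply: isoN; apply: (adapted_isomorphic (ad k) (ad j)).
apply/ffunP => i; apply/val_inj/eqP; rewrite /= eqn_leq tkj /= leqNgt.
apply/negP => lt; have := minj k dk; rewrite leqNgt => /negP[].
rewrite (bigD1 i) //= [X in (_ < X)%N](bigD1 i) //= -addSn leq_add //.
by apply: leq_sum => i' _; apply: tkj.
Qed.

End NestedIndependence.

(** * The flat size functional *)

Section Averaging.
Variables (R : realType) (T : finType) (M : matroid T).
Implicit Types s : {perm T}.

Lemma segment_tperm s (i j : 'I_#|T|) k : (k <= i)%N -> (i <= j)%N ->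
  segment (s * tperm (enum_val i) (enum_val j))%g k = segment s k.
Proof.
move=> ki ij; apply/setP => x; rewrite !inE permM.
case: tpermP => [->|->|//]; rewrite !enum_valK.
  by rewrite !ltnNge ki (leq_trans ki ij).
by rewrite !ltnNge ki (leq_trans ki ij).
Qed.

(* Conditionally on the first i elements, the next one is uniformly
   distributed among the others. *)
Lemma sum_next_in_closure (i : 'I_#|T|) (phi : {perm T} -> R) :
    (forall s s', (forall k, (k <= i)%N -> segment s k = segment s' k) ->
       phi s = phi s') ->
  \sum_s phi s * (rank M (segment s i.+1) == rank M (segment s i))%:R * (#|T| - i)%:R =
  \sum_s phi s * (#|cl M (segment s i)| - i)%:R.
Proof.
move=> hphi.
pose inc s (j : 'I_#|T|) := (s^-1)%g (enum_val j) \in cl M (segment s i).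
(* Exchanging positions [i] and [j] keeps the first [i] elements and moves the element at position
   [j] to position [i]. *)
have swap (j : 'I_#|T|) : (i <= j)%N ->
    \sum_s phi s * (inc s i)%:R = \sum_s phi s * (inc s j)%:R.
  move=> ij; rewrite (reindex_inj (mulIg (tperm (enum_val i) (enum_val j)))) /=.
  apply: eq_bigr => s _; rewrite /inc segment_tperm // invMg permM tpermV tpermL.
  by congr (_ * _); apply: hphi => k ki; rewrite segment_tperm.
transitivity (\sum_(j : 'I_#|T| | (i <= j)%N) \sum_s phi s * (inc s i)%:R).
  rewrite sumr_const.
  have -> : #|[pred j : 'I_#|T| | (i <= j)%N]| = (#|T| - i)%N.
    rewrite -sum1_card -(big_geq_mkord _ _ predT (fun=> 1%N)) sum_nat_const_nat.
    by rewrite muln1.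
  rewrite -[RHS]mulr_natr mulr_suml; apply: eq_bigr => s _; rewrite /inc inE.
  by rewrite segment_next.
rewrite (eq_bigr _ swap) exchange_big /=; apply: eq_bigr => s _.
rewrite -mulr_sumr; congr (_ * _).
have -> : (#|cl M (segment s i)| - i)%N = #|cl M (segment s i) :\: segment s i|.
  by rewrite cardsDS ?sub_cl // card_segment // ltnW.
rewrite -[#|_ :\: _|]sum1_card natr_sum.
rewrite [RHS](reindex (fun j : 'I_#|T| => (s^-1)%g (enum_val j : T))) /=; last first.
  exists (fun x => enum_rank (s x)) => [j _|x _]; first by rewrite permKV enum_valK.
  by rewrite enum_rankK permK.
rewrite big_mkcond [RHS]big_mkcond; apply: eq_bigr => j _.
rewrite in_setD segmentE permKV enum_valK -leqNgt /inc.
by case: (i <= j)%N; case: (_ \in _).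
Qed.

End Averaging.

(** * Random orders and prescribed flat sizes *)

Section PerfectMatroidDesign.
Variables (R : realType) (T : finType) (alpha : nat -> int).
Implicit Types (M N : matroid T) (s : {perm T}) (A F : {set T}).
Notation rank_sequence := {ffun 'I_#|T|.+1 -> 'I_#|T|.+1}.

Definition has_flat_sizes M := forall F, flat M F -> #|F|%:Z = alpha (rank M F).

Let a k : R := (alpha k)%:~R.

Lemma card_cl M A : has_flat_sizes M -> #|cl M A|%:R = a (rank M A).
Proof. by move=> hM; rewrite /a -(rank_cl M A) -hM // flat_cl. Qed.

Definition history M s (t : nat -> nat) i :=
  all (fun j => rank M (segment s j) == t j) (iota 0 i).

Lemma historyS M s t i :
  history M s t i.+1 = history M s t i && (rank M (segment s i) == t i).
Proof. by rewrite /history -addn1 iotaD all_cat /= andbT. Qed.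

Lemma history_ext M s s' t i : (forall k, (k < i)%N -> segment s k = segment s' k) ->
  history M s t i = history M s' t i.
Proof. by move=> h; apply: eq_in_all => k; rewrite mem_iota => /h ->. Qed.

(* The rank increments of a random order form a Markov chain whose transition
   probabilities only depend on alpha. *)
Lemma sum_history M N t i : has_flat_sizes M -> has_flat_sizes N -> (i <= #|T|)%N ->
  \sum_(s : {perm T}) (history M s t i.+1)%:R =
  \sum_(s : {perm T}) (history N s t i.+1)%:R :> R.
Proof.
move=> hM hN; elim: i => [|i IH] iT.
  apply: eq_bigr => s _; rewrite /history /= !segment0.
  have := rank_le_card M set0; have := rank_le_card N set0.
  by rewrite cards0 !leqn0 => /eqP-> /eqP->.
have {}IH := IH (ltnW iT); pose oi := Ordinal iT.
pose stay K := \sum_(s : {perm T}) (history K s t i.+1)%:R *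
  (rank K (segment s i.+1) == rank K (segment s i))%:R : R.
(* Given the history, the first [i] elements have a closure of size [alpha (t i)], so the rank stays
   with conditional probability [(alpha (t i) - i) / (#|T| - i)]. *)
have stayE K : has_flat_sizes K ->
    stay K * (#|T| - i)%:R =
    (\sum_(s : {perm T}) (history K s t i.+1)%:R) * (a (t i) - i%:R).
  move=> hK; rewrite mulr_suml (@sum_next_in_closure R T K oi) /=; last first.
    by move=> s s' h; congr ((nat_of_bool _)%:R); apply: history_ext.
  rewrite mulr_suml; apply: eq_bigr => s _; rewrite historyS.
  have [/eqP rt|_] := boolP (rank K (segment s i) == t i); last by rewrite andbF !mul0r.
  rewrite natrB; last by rewrite -{1}(card_segment s (ltnW iT)) subset_leq_card ?sub_cl.
  by rewrite card_cl // rt.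
have stayMN : stay M = stay N.
  have Ti : (#|T| - i)%:R != 0 :> R by rewrite pnatr_eq0 subn_eq0 -ltnNge.
  by apply: (mulIf Ti); rewrite !stayE // IH.
(* The rank stays or grows by one, so the next count is [stay K], its complement in the previous
   count, or zero. *)
suff step K : \sum_(s : {perm T}) (history K s t i.+2)%:R =
    if t i.+1 == t i then stay K
    else if t i.+1 == (t i).+1 then \sum_(s : {perm T}) (history K s t i.+1)%:R - stay K
    else 0.
  by rewrite !step IH stayMN.
have le s : (rank K (segment s i) <= rank K (segment s i.+1) <= (rank K (segment s i)).+1)%N.
  by rewrite rankS ?segmentS //= (segment_next s oi) rankU1.
have hS s : history K s t i.+2 = history K s t i.+1 && (rank K (segment s i.+1) == t i.+1).
  exact: historyS.
have hS' s : history K s t i.+1 -> rank K (segment s i) = t i.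
  by rewrite historyS => /andP[_ /eqP].
case: eqP => [e|ne].
  apply: eq_bigr => s _; rewrite hS; case: (boolP (history K s t i.+1)) => [/hS' e'|].
    by rewrite mul1r e e'.
  by rewrite mul0r.
case: eqP => [e|ne'].
  rewrite -sumrB; apply: eq_bigr => s _; rewrite hS.
  case: (boolP (history K s t i.+1)) => [/hS' e'|]; last by rewrite mul0r subrr.
  rewrite mul1r e e' /=; have := le s; rewrite e'.
  case/andP; rewrite leq_eqVlt => /orP[/eqP<- _|lt ge].
    by rewrite eqxx ltn_eqF // subrr.
  by rewrite eqn_leq ge lt gtn_eqF // subr0.
rewrite big1 // => s _; rewrite hS.
case: (boolP (history K s t i.+1)) => //= /hS' e'.
have := le s; rewrite e' => /andP[]; rewrite leq_eqVlt => /orP[/eqP<- _|lt ge].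
  by case: eqP ne => // ->.
have -> : rank K (segment s i.+1) = (t i).+1 by apply/eqP; rewrite eqn_leq ge lt.
by case: eqP ne' => // ->.
Qed.

Lemma rkseq_distribution M N (l : rank_sequence -> R) :
  has_flat_sizes M -> has_flat_sizes N ->
  \sum_(s : {perm T}) l (rkseq M s) = \sum_(s : {perm T}) l (rkseq N s).
Proof.
move=> hM hN; have E K : \sum_(s : {perm T}) l (rkseq K s) =
    \sum_(t : rank_sequence) l t *
      \sum_(s : {perm T}) (history K s (fun k => t (inord k)) #|T|.+1)%:R.
  under [RHS]eq_bigr do rewrite mulr_sumr.
  rewrite exchange_big /=; apply: eq_bigr => s _.
  have hE (t : rank_sequence) : history K s (fun k => t (inord k)) #|T|.+1 = (t == rkseq K s).
    apply/allP/eqP => [h|-> k].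
      apply/ffunP => k; apply/val_inj; rewrite /= rkseqE.
      have /h/eqP -> : val k \in iota 0 #|T|.+1 by rewrite mem_iota /= ltn_ord.
      by rewrite inord_val.
    by rewrite mem_iota => /= kT; rewrite rkseqE inordK.
  rewrite (bigD1 (rkseq K s)) //= hE eqxx mulr1 big1 ?addr0 // => t /negPf nt.
  by rewrite hE nt mulr0.
by rewrite !E; apply: eq_bigr => t _; rewrite (@sum_history M N).
Qed.

(** A closure size cannot be read off one rank sequence; summed over all orders, however,
    [#|cl A| - i] agrees with [#|T| - i] times the indicator that the rank stays at step [i]. *)
Let gain (t : rank_sequence) : R := \sum_(i < #|T|)
  ((t (inord i.+1) == t (inord i) :> nat)%:R * (#|T| - i)%:R - (a (t (inord i)) - i%:R)).

Let oversized (t : rank_sequence) := [exists k, a (t k) < (k : nat)%:R].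

(** A bound for the total gain of any matroid on [T]: the sum over all possible ranks [k] dominates
    the term of whichever rank occurs. *)
Let bound : R := \sum_(s : {perm T}) \sum_(i < #|T|) \sum_(k < #|T|.+1) (#|T|%:R + `|a k|).

(* On matroids without oversized flats, gain sums the defects |cl A| - alpha_(r A)
   over the initial segments A of all orders; the penalty excludes all others. *)
Definition flat_size_functional (t : rank_sequence) : R :=
  gain t - (bound + 1) * (oversized t)%:R.

Lemma sum_gain M : \sum_(s : {perm T}) gain (rkseq M s) =
  \sum_(s : {perm T}) \sum_(i < #|T|) (#|cl M (segment s i)|%:R - a (rank M (segment s i))).
Proof.
rewrite /gain exchange_big /= [RHS]exchange_big /=; apply: eq_bigr => i _.
have rE s k : (k <= #|T|)%N -> rkseq M s (inord k) = rank M (segment s k) :> nat.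
  by move=> kT; rewrite rkseqE inordK.
have e : \sum_s (rank M (segment s i.+1) == rank M (segment s i))%:R * (#|T| - i)%:R =
    \sum_s (#|cl M (segment s i)| - i)%:R :> R.
  have := @sum_next_in_closure R T M i (fun=> 1) (fun _ _ _ => erefl).
  rewrite (eq_bigr _ (fun s _ => mul1r _)) => <-.
  by apply: eq_bigr => s _; rewrite mul1r.
have jE s : (rkseq M s (inord i.+1) == rkseq M s (inord i) :> nat) =
    (rank M (segment s i.+1) == rank M (segment s i)).
  by rewrite rE // rE 1?ltnW.
rewrite sumrB; under [X in X - _]eq_bigr do rewrite jE.
rewrite e -!sumrB; apply: eq_bigr => s _; rewrite rE 1?ltnW //.
rewrite natrB; last first.
  by rewrite -{1}(card_segment s (ltnW (ltn_ord i))) subset_leq_card ?sub_cl.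
by rewrite opprB addrA subrK.
Qed.

Lemma flat_size_functional_eq0 M : has_flat_sizes M ->
  \sum_(s : {perm T}) flat_size_functional (rkseq M s) = 0.
Proof.
move=> hM; rewrite sumrB sum_gain big1 => [|s _]; last first.
  by rewrite big1 // => i _; rewrite card_cl // subrr.
rewrite big1 ?subr0 // => s _.
suff /negPf -> : ~~ oversized (rkseq M s) by rewrite mulr0.
rewrite negb_exists; apply/forallP => k; rewrite -leNgt rkseqE -card_cl // ler_nat.
by rewrite -{1}(@card_segment _ s k) ?subset_leq_card ?sub_cl // -ltnS.
Qed.

(** One oversized initial segment costs more than any possible gain. Without any, every set
    satisfies [#|A| <= alpha (rank M A)]; applied to closures, this makes all defects nonpositive,
    and if their sum vanished, every flat would have the prescribed size. *)
Lemma flat_size_functional_lt0 M : a (rk M) = #|T|%:R -> ~ has_flat_sizes M ->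
  \sum_(s : {perm T}) flat_size_functional (rkseq M s) < 0.
Proof.
move=> aT nM; rewrite sumrB -mulr_sumr sum_gain.
have [/existsP[s0 os0]|ok] := boolP [exists s, oversized (rkseq M s)].
  rewrite subr_lt0; apply: (@le_lt_trans _ _ bound).
    rewrite ler_sum // => s _; rewrite ler_sum // => i _.
    have rT : (rank M (segment s i) < #|T|.+1)%N.
      by rewrite ltnS (leq_trans (rank_le_card _ _)) ?max_card.
    rewrite (bigD1 (Ordinal rT)) //= -[leLHS]addr0 lerD //.
      by rewrite lerD ?ler_nat ?max_card // -normrN ler_norm.
    by rewrite sumr_ge0 // => k _; rewrite addr_ge0.
  apply: (@lt_le_trans _ _ ((bound + 1) * 1)); first by rewrite mulr1 ltrDl.
  have b0 : 0 <= bound.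
    by do 3![apply: sumr_ge0 => ? _]; rewrite addr_ge0.
  rewrite ler_pM2l ?ltr_wpDl // (bigD1 s0) //= os0 lerDl.
  exact: sumr_ge0.
rewrite [X in _ - _ * X]big1 => [|s _]; last first.
  by have := forallP (eq_ind _ is_true ok _ (negb_exists _)) s => /negPf->.
rewrite mulr0 subr0.
have le s k : (k <= #|T|)%N -> k%:R <= a (rank M (segment s k)).
  move=> kT; rewrite leNgt; apply: contra ok => lt; apply/existsP; exists s.
  by apply/existsP; exists (inord k); rewrite rkseqE inordK.
have leA A : #|A|%:R <= a (rank M A).
  by have [s hs] := set_segment A; rewrite -{2}hs le ?max_card.
rewrite lt_neqAle; apply/andP; split; last first.
  rewrite sumr_le0 // => s _; rewrite sumr_le0 // => i _.
  by rewrite subr_le0 -(rank_cl M (segment s i)).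
apply/eqP => e; apply: nM => F fF; apply/eqP; rewrite -(eqr_int R) -/(a _).
have [->|FT] := eqVneq F [set: T]; first by rewrite cardsT -/(rk M) aT.
have ltF : (#|F| < #|T|)%N by rewrite -cardsT proper_card // properT.
have [s hs] := set_segment F.
have := e; rewrite -[LHS]opprK -sumrN => /eqP; rewrite oppr_eq0.
rewrite psumr_eq0 => [/allP/(_ s (mem_index_enum _))|s' _]; last first.
  rewrite oppr_ge0 sumr_le0 // => i _.
  by rewrite subr_le0 -(rank_cl M (segment s' i)).
rewrite -sumrN psumr_eq0 => [/allP/(_ (Ordinal ltF) (mem_index_enum _))|i _] /=; last first.
  by rewrite oppr_ge0 subr_le0 -(rank_cl M (segment s i)).
by rewrite hs oppr_eq0 subr_eq0 cl_flat.
Qed.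

End PerfectMatroidDesign.

(** * Projective and affine geometries *)

Section TruncatedDesign.
Variables (T : finType) (M : matroid T) (k : nat).

Lemma rank_truncation (A : {set T}) : rank (truncation M k) A = minn (rank M A) k.
Proof.
apply/eqP; rewrite eqn_leq; apply/andP; split.
  apply: rank_le => I; rewrite inE => /andP[iI Ik] sIA.
  by rewrite leq_min Ik andbT indep_le_rank.
have [J [+ sJA cJ]] := rank_witness (truncation M k) A.
rewrite inE => /andP[iJ Jk]; rewrite leqNgt; apply/negP; rewrite -cJ leq_min.
case/andP=> JA Jk'; have [I [iI sIA cI]] := rank_witness M A.
rewrite -cI in JA; have [x /setDP[xI xJ] ixJ] := indep_augment iJ iI JA.
have := @indep_le_rank _ (truncation M k) (x |: J) A.
rewrite inE ixJ cardsU1 xJ -cJ subUset sub1set sJA (subsetP sIA _ xI) add1n ltnn.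
by move/(_ Jk' isT).
Qed.

(** Flats of rank below [k] in the truncation are flats of [M], and the only other flat is the
    ground set. *)
Lemma truncation_design : perfect_matroid_design M -> perfect_matroid_design (truncation M k).
Proof.
case=> alpha hM; exists (fun j => if (j < k)%N then alpha j else #|T|%:Z) => F /forallP fF.
rewrite rank_truncation; have [ltF|leF] := ltnP (rank M F) k.
  rewrite ltF; apply: hM; apply/forallP => x; apply/implyP => xF.
  have := implyP (fF x) xF; rewrite !rank_truncation (minn_idPl (ltnW ltF)) leq_min.
  by case/andP.
rewrite ltnn; suff -> : F = [set: T] by rewrite cardsT.
apply/setP => x; rewrite inE; apply: contraT => xF.
have := implyP (fF x) xF; rewrite !rank_truncation (minn_idPr leF) leq_min ltnn.
by rewrite andbF.
Qed.

End TruncatedDesign.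

Section SubspaceDesign.
Variables (T : finType) (F : fieldType) (m : nat) (W : T -> 'M[F]_m).
Hypothesis rankW : forall t, (\rank (W t) <= 1)%N.
Let M := subspace_matroid rankW.
Let span (A : {set T}) := (\sum_(t in A) W t)%MS.

Lemma rank_subspace (A : {set T}) : rank M A = \rank (span A).
Proof.
apply/eqP; rewrite eqn_leq; apply/andP; split.
  apply: rank_le => I; rewrite inE => /eqP <- sIA; apply: mxrankS.
  apply/sumsmx_subP => t tI; apply: (sumsmx_sup t) => //.
  exact: subsetP sIA _ tI.
have [I [iI sIA cI]] := rank_witness M A.
rewrite -cI; have := iI; rewrite inE => /eqP rI; rewrite -rI mxrankS //.
apply/sumsmx_subP => x xA; apply: contraT => nWx.
have xI : x \notin I by apply: contra nWx => xI; apply: (sumsmx_sup x).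
suff ixI : x |: I \in indep M.
  have : (#|x |: I| <= rank M A)%N by rewrite indep_le_rank // subUset sub1set xA.
  by rewrite cardsU1 xI add1n cI ltnn.
rewrite inE eqn_leq rank_span_le // cardsU1 xI add1n -rI /=.
by rewrite big_setU1 //=; rewrite rank_ltmx // ltmxE addsmxSr /= addsmx_sub submx_refl andbT.
Qed.

Lemma flat_subspace (A : {set T}) : flat M A -> A = [set t | (W t <= span A)%MS].
Proof.
move=> /forallP fA; apply/setP => x; rewrite inE; apply/idP/idP => [xA|le].
  exact: (sumsmx_sup x).
apply: contraT => xA; have := implyP (fA x) xA; rewrite !rank_subspace ltnNge.
by rewrite mxrankS // /span big_setU1 //= addsmx_sub le submx_refl.
Qed.

End SubspaceDesign.

Section ProjectiveDesign.
Variables (F : finFieldType) (d : nat).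

Lemma point_eq (P : {P | is_point P}) (v : 'rV[F]_d.+1) :
  v != 0 -> (v <= val P)%MS -> val P = <<v>>%MS.
Proof.
case: P => P /= /andP[/eqP eP /eqP rP] v0 vP; rewrite eP.
by apply/esym/genmxP; rewrite -(mxrank_leqif_eq vP).2 rank_rV v0 rP.
Qed.

(* Double counting of the pairs (v, P) with v a nonzero vector of the point P. *)
Lemma card_points (U : 'M[F]_d.+1) :
  (#|[set P : {P : 'M[F]_d.+1 | is_point P} | (val P <= U)%MS]| * (#|F| - 1) =
   #|F| ^ \rank U - 1)%N.
Proof.
have cnt (A : 'M[F]_d.+1) :
    (\sum_(v : 'rV[F]_d.+1 | (v != 0%R) && (v <= A)%MS) 1 = #|F| ^ \rank A - 1)%N.
  have := card_rowg A; rewrite -sum1_card (bigD1 0) /=; last by rewrite mem_rowg sub0mx.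
  move=> <-; rewrite add1n subn1 /=; apply: eq_bigl => v.
  by rewrite mem_rowg andbC.
rewrite -cnt -sum_nat_const.
transitivity (\sum_(P in [set P : {P : 'M[F]_d.+1 | is_point P} | (val P <= U)%MS])
   \sum_(v : 'rV[F]_d.+1 | (v != 0%R) && (v <= val P)%MS) 1)%N.
  apply: eq_bigr => P _; rewrite cnt.
  by case: P => P /= /andP[_ /eqP->]; rewrite expn1.
rewrite (exchange_big_dep (fun v : 'rV[F]_d.+1 => (v != 0%R) && (v <= U)%MS)) /=; last first.
  by move=> P v; rewrite inE => PU /andP[-> /submx_trans->].
apply: eq_bigr => v /andP[v0 vU].
have pv : is_point (<<v>>%MS : 'M[F]_d.+1).
  by rewrite /is_point genmx_id eqxx mxrank_gen rank_rV v0.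
rewrite (big_pred1 (exist _ <<v>>%MS pv)) // => P; rewrite inE v0 /=.
apply/andP/eqP => [[_ /(point_eq v0) e]|->]; first exact: val_inj.
by rewrite !genmxE.
Qed.

Lemma PG_design : perfect_matroid_design (PG F d).
Proof.
exists (fun k => ((#|F| ^ k - 1) %/ (#|F| - 1))%N%:Z) => A fA; congr Posz.
rewrite rank_subspace; set U := (\sum_(t in A) _)%MS.
have q1 : (0 < #|F| - 1)%N by rewrite subn_gt0 finNzRing_gt1.
by rewrite -card_points mulnK // [in LHS](flat_subspace fA).
Qed.

End ProjectiveDesign.

Section AffineDesign.
Variables (F : finFieldType) (d : nat).

Lemma rank_AG (A : {set 'rV[F]_d}) :
  rank (AG F d) A = rank (subspace_matroid (@homog_rank F d)) A.
Proof. by rewrite /rank /= affinely_independentE. Qed.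

Lemma flat_AG (A : {set 'rV[F]_d}) :
  flat (AG F d) A = flat (subspace_matroid (@homog_rank F d)) A.
Proof. by apply: eq_forallb => x; rewrite !rank_AG. Qed.

(** Adding multiples of [h v0] to the vectors of [U] with first coordinate 1 reaches each vector of
    [U] exactly once. *)
Lemma card_affine_section (U : 'M[F]_(1 + d)) (v0 : 'rV[F]_d) : (homog v0 <= U)%MS ->
  (#|F| * #|[set v | (homog v <= U)%MS]| = #|F| ^ \rank U)%N.
Proof.
rewrite genmxE => v0U; pose h v : 'rV[F]_(1 + d) := row_mx (1%:M : 'M_1) v.
pose f (p : F * 'rV[F]_d) := h p.2 + p.1 *: h v0.
have hl v : lsubmx (h v) = 1%:M by rewrite row_mxKl.
have hr v : rsubmx (h v) = v by rewrite row_mxKr.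
have f_inj : injective f.
  move=> [c v] [c' v'] e; have := congr1 lsubmx e; have := congr1 rsubmx e.
  rewrite /f !linearD !linearZ /= !hr !hl => er /addrI /matrixP/(_ 0 0).
  rewrite !mxE eqxx !mulr1 => ec; rewrite ec in er *.
  by move/addIr: er => ->.
rewrite -card_rowg -cardsT -cardsX -(card_imset _ f_inj).
apply: eq_card => w; rewrite mem_rowg; apply/imsetP/idP.
  case=> -[c v]; rewrite !inE genmxE /= => vU ->.
  by rewrite addmx_sub // scalemx_sub.
move=> wU; pose c := lsubmx w 0 0 - 1; pose w' := w - c *: h v0.
have w'l : lsubmx w' = 1%:M.
  rewrite /w' linearB linearZ /= hl; apply/matrixP => i j; rewrite !ord1 !mxE eqxx.
  by rewrite mulr1 /c !mxE opprB addrC subrK.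
have w'E : w' = h (rsubmx w') by rewrite -{1}[w']hsubmxK w'l.
exists (c, rsubmx w'); last by rewrite /f /= -w'E subrK.
rewrite !inE genmxE /= -/(h _) -w'E /w'.
by rewrite addmx_sub // eqmx_opp scalemx_sub.
Qed.

Lemma AG_design : perfect_matroid_design (AG F d).
Proof.
exists (fun k => (if k is k'.+1 then #|F| ^ k' else 0)%N%:Z) => A.
rewrite flat_AG => fA; congr Posz; rewrite rank_AG.
have [->|[v vA]] := set_0Vmem A.
  by rewrite cards0 rank_subspace big_set0 mxrank0.
rewrite rank_subspace; set U := (\sum_(t in A) _)%MS.
have vU : (homog v <= U)%MS by apply: (sumsmx_sup v).
have q0 : (0 < #|F|)%N by rewrite (ltn_trans _ (finNzRing_gt1 F)).
have cA : (#|F| * #|A| = #|F| ^ \rank U)%N.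
  by rewrite -(card_affine_section vU) [in LHS](flat_subspace fA).
have : (0 < \rank U)%N.
  apply: leq_trans (mxrankS vU); rewrite mxrank_gen lt0n mxrank_eq0 -row_mx0.
  apply/eqP => /eq_row_mx[/matrixP/(_ 0 0)/eqP]; rewrite !mxE eqxx oner_eq0.
  by [].
case: (\rank U) cA => // k; rewrite expnS => /eqP.
by rewrite eqn_pmul2l // => /eqP.
Qed.

End AffineDesign.

(** * Extremality *)

Section Extremal.
Variables (R : realType) (T : finType).
Implicit Types M N : matroid T.

Lemma isomorphic_polytope M N : isomorphic M N -> exists p : {perm T},
  forall x : {ffun T -> R}, base_polytope N x <-> base_polytope M [ffun e => x (p e)].
Proof.
case=> f /bij_inj f_inj fI; exists (perm f_inj) => x.
have rankE A : rank M A = rank N (f @: A).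
  apply/eqP; rewrite eqn_leq; apply/andP; split.
    have [I [iI sIA <-]] := rank_witness M A.
    by rewrite -(card_imset _ f_inj) indep_le_rank ?fI ?imsetS.
  have [I [iI sIA <-]] := rank_witness N (f @: A).
  have eI : f @: (f @^-1: I) = I.
    apply/setP => y; apply/imsetP/idP => [[z + ->]|yI]; first by rewrite inE.
    have /imsetP[z zA yE] := subsetP sIA _ yI; exists z; rewrite // inE -yE.
    exact: yI.
  rewrite -{1}eI (card_imset _ f_inj) indep_le_rank //; first by rewrite -fI eI.
  apply/subsetP => z; rewrite inE => /(subsetP sIA)/imsetP[z' z'A].
  by move/f_inj->.
have fT : f @: [set: T] = [set: T].
  by apply/eqP; rewrite eqEcard subsetT card_imset ?leqnn.
have sumE (A : {set T}) :
    \sum_(e in A) [ffun e => x (perm f_inj e)] e = \sum_(e in f @: A) x e.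
  rewrite big_imset /=; last by move=> ? ? _ _; apply: f_inj.
  by apply: eq_bigr => e _; rewrite ffunE permE.
have sumTE : \sum_e [ffun e => x (perm f_inj e)] e = \sum_e x e.
  by have := sumE [set: T]; rewrite fT !(eq_bigl _ _ (in_setT (T:=T))).
split=> /base_polytope_rank[h1 h2 h3]; apply/base_polytope_rank; split.
- by move=> e; rewrite ffunE.
- by move=> A; rewrite sumE rankE.
- by rewrite sumTE h3 /rk rankE fT.
- by move=> e; have := h1 ((perm f_inj)^-1%g e); rewrite ffunE permKV.
- move=> A; have eA : f @: (f @^-1: A) = A.
    apply/setP => y; apply/imsetP/idP => [[z + ->]|yI]; first by rewrite inE.
    exists ((perm f_inj)^-1%g y); last by rewrite -[RHS](permE f_inj) permKV.
    by rewrite inE -(permE f_inj) permKV.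
  by have := h2 (f @^-1: A); rewrite sumE rankE eA.
- by rewrite -sumTE h3 /rk rankE fT.
Qed.

Lemma isomorphic_sym_indic M N (x : {ffun T -> R}) : isomorphic M N ->
  sym_indic (base_polytope M) x = sym_indic (base_polytope N) x.
Proof.
move=> /isomorphic_polytope[p hp]; rewrite /sym_indic; congr (_ * _).
rewrite (reindex_inj (mulgI p)) /=; apply: eq_bigr => s _.
rewrite !indicE; congr ((nat_of_bool _)%:R).
have -> : [ffun e => x ((p * s)%g e)] = [ffun e => [ffun e => x (s e)] (p e)].
  by apply/ffunP => e; rewrite !ffunE permM.
by apply/idP/idP => /set_mem/hp/mem_set.
Qed.

Variables (r : nat) (N : 'I_('C(#|T|, r)) -> matroid T).
Hypothesis repN : nested_representatives N.

Lemma nested_vector_exists M : rk M = r -> exists v : {ffun 'I_('C(#|T|, r)) -> R},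
  nested_vector N M v.
Proof.
move=> rM; have [_ _ hN] := repN; have [K [KP KE]] := nested_expansion R M.
have /choice[j hj] : forall D, exists j, is_chain D -> isomorphic (K D) (N j).
  move=> D; have [chD|_] := boolP (is_chain D).
    by have [nK rK] := KP D chD; have [j hj] := hN _ nK (etrans rK rM); exists j.
  (* A set [D] that is not a chain needs some index too; the empty chain supplies one. *)
  have chT : is_chain (set0 : {set {set T}}) by apply/is_chainP => A B; rewrite inE.
  by have [nK rK] := KP _ chT; have [j hj] := hN _ nK (etrans rK rM); exists j.
pose c i : int := \sum_(D | is_chain D && (j D == i)) chain_coef D.
exists [ffun i => (c i)%:~R]; exists c => // x.
transitivity (\sum_(D | is_chain D) (chain_coef D)%:~R * sym_indic (base_polytope (K D)) x).
  rewrite {1}/sym_indic; under eq_bigr do rewrite KE.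
  rewrite exchange_big /= mulr_sumr; apply: eq_bigr => D _.
  by rewrite /sym_indic mulrCA -mulr_sumr.
rewrite (partition_big j predT) //=; apply: eq_bigr => i _.
rewrite /c rmorph_sum /= mulr_suml; apply: eq_bigr => D /andP[chD /eqP <-].
by rewrite (isomorphic_sym_indic _ (hj D chD)).
Qed.

(** Moving [M] to the other side, as the extra index [None], turns its expansion into one linear
    relation between indicators, to which valuativity applies. *)
Lemma nested_vector_rkseq M (v : {ffun 'I_('C(#|T|, r)) -> R})
    (l : {ffun 'I_#|T|.+1 -> 'I_#|T|.+1} -> R) :
    nested_vector N M v ->
  \sum_(s : {perm T}) l (rkseq M s) = \sum_j v j * \sum_(s : {perm T}) l (rkseq (N j) s).
Proof.
case=> c -> hc; pose K (o : option 'I_('C(#|T|, r))) := if o is Some j then N j else M.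
pose d (o : option 'I_('C(#|T|, r))) : R := if o is Some j then - (c j)%:~R else 1.
have big_option (f : option 'I_('C(#|T|, r)) -> R) :
    \sum_o f o = f None + \sum_j f (Some j).
  rewrite (bigD1 None) //=; congr (_ + _).
  rewrite (reindex_omap Some id) /=; last by case.
  by apply: eq_bigl => j; rewrite eqxx.
have h x : \sum_o d o * sym_indic (base_polytope (K o)) x = 0.
  rewrite big_option /= mul1r hc -big_split big1 // => j _.
  by rewrite /= mulNr subrr.
have := valuative_rkseq h l; rewrite big_option /= mul1r => /eqP.
rewrite addr_eq0 -sumrN => /eqP->; apply: eq_bigr => j _.
by rewrite mulNr opprK ffunE.
Qed.

Lemma nested_vector_inj M M' (v v' : {ffun 'I_('C(#|T|, r)) -> R}) :
    (forall l : {ffun 'I_#|T|.+1 -> 'I_#|T|.+1} -> R,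
       \sum_(s : {perm T}) l (rkseq M s) = \sum_(s : {perm T}) l (rkseq M' s)) ->
    nested_vector N M v -> nested_vector N M' v' -> v = v'.
Proof.
move=> hl hv hv'; have [nN iN _] := repN.
have E := @nested_rkseq_independent R T _ N (fun j => v j - v' j) (fun j => (nN j).1) iN.
apply/ffunP => j; apply/eqP; rewrite -subr_eq0; apply/eqP; apply: E => l.
under eq_bigr do rewrite mulrBl.
by rewrite sumrB -(nested_vector_rkseq l hv) -(nested_vector_rkseq l hv') hl subrr.
Qed.

End Extremal.

Lemma design_extremal (R : realType) (T : finType) (M : matroid T) :
  perfect_matroid_design M -> extremal R M.
Proof.
case=> alpha hM N repN; have [v hv] := nested_vector_exists R repN (erefl (rk M)).
exists v => //; pose l := @flat_size_functional R T alpha.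
have lM : \sum_(s : {perm T}) l (rkseq M s) = 0 by apply: flat_size_functional_eq0.
have aT : (alpha (rk M))%:~R = #|T|%:R :> R.
  by rewrite -hM ?cardsT ?flatT.
split.
  exists 1%N, (fun=> v), (fun=> 1); split=> [i|i||j]; rewrite ?big_ord1 ?mul1r //.
  by exists M.
(* The coordinates are the values of the flat size functional on the [N j]; by linearity, pairing
   with the vector of any matroid gives the value on that matroid. *)
exists [ffun j => \sum_(s : {perm T}) l (rkseq (N j) s)] => x [k [p [w [hp w_ge0 w_sum xE]]]] xv.
have valE K v' : nested_vector N K v' ->
    \sum_j [ffun j => \sum_(s : {perm T}) l (rkseq (N j) s)] j * v' j =
    \sum_(s : {perm T}) l (rkseq K s).
  move=> /nested_vector_rkseq ->; apply: eq_bigr => j _.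
  by rewrite ffunE mulrC.
rewrite (valE M v hv) lM.
have /choice[K hK] : forall i, exists K, rk K = rk M /\ nested_vector N K (p i).
  by move=> i; have [K rK hK] := hp i; exists K.
have lt0 i : p i <> v -> \sum_(s : {perm T}) l (rkseq (K i) s) < 0.
  move=> pv; apply: flat_size_functional_lt0; first by rewrite (hK i).1.
  (* With the flat sizes [alpha], the matroid [K i] would share its rank sequence distribution with
     [M], and hence its vector. *)
  move=> hKi; apply: pv; apply: (nested_vector_inj repN _ (hK i).2 hv) => l'.
  exact: rkseq_distribution hKi hM.
have le0 i : \sum_(s : {perm T}) l (rkseq (K i) s) <= 0.
  have [pv|/lt0/ltW //] := pselect (p i = v).
  by rewrite -(valE _ _ (hK i).2) pv (valE M v hv) lM.
have -> : \sum_j [ffun j => \sum_(s : {perm T}) l (rkseq (N j) s)] j * x j =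
    \sum_i w i * \sum_(s : {perm T}) l (rkseq (K i) s).
  under eq_bigr do rewrite xE mulr_sumr.
  rewrite exchange_big /=; apply: eq_bigr => i _.
  rewrite -(valE _ _ (hK i).2) mulr_sumr; apply: eq_bigr => j _.
  by rewrite mulrCA.
(* A combination different from [v] gives nonzero weight to a point different from [v], and that
   term is strictly negative. *)
have [i0 wi0 pi0] : exists2 i, w i != 0 & p i <> v.
  apply: contrapT => nex; apply: xv; apply/ffunP => j; rewrite xE.
  rewrite -[RHS]mul1r -w_sum mulr_suml; apply: eq_bigr => i _.
  have [->|wi] := eqVneq (w i) 0; first by rewrite !mul0r.
  have -> // : p i = v; apply: contrapT => pv; apply: nex; by exists i.
rewrite (bigD1 i0) //= -[ltRHS]addr0 ltr_leD //.
  by rewrite pmulr_rlt0 ?lt0 // lt_neqAle eq_sym wi0 w_ge0.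
by rewrite sumr_le0 // => i _; rewrite mulr_ge0_le0.
Qed.

Local Close Scope ring_scope.

Theorem theorem3p1 (R : realType) :
  (forall (T : finType) (M : matroid T),
     perfect_matroid_design M -> extremal R M) /\
  (forall (F : finFieldType) (r : nat), (0 < r)%N ->
     [/\ extremal R (PG F r.-1),
         extremal R (AG F r.-1),
         forall i : nat, (i <= r)%N ->
           extremal R (truncation (PG F r.-1) (r - i)) &
         forall i : nat, (i <= r)%N ->
           extremal R (truncation (AG F r.-1) (r - i))]).
Proof.
split=> [T M|F r _]; first exact: design_extremal.
have hP := PG_design F r.-1; have hA := AG_design F r.-1.
by split=> [||i _|i _]; apply: design_extremal => //; apply: truncation_design.
Qed.
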